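(* Let $\beta>0$. There exist constants $c,C>0$, independent of $n$ and $m$, such that the following holds for every $m$. Let $\mathbb S^m$ be the unit $m$-sphere, let $f_{\mathrm{vMF}}(x;\alpha,\beta)$ be the von Mises-Fisher density on $\mathbb S^m$, let $\alpha^{\mathrm{tr}}\in\mathbb S^m$, and let $$\hat\alpha^{\mathrm{MLE}}=\operatorname*{argmax}_{\alpha\in\mathbb S^m}\sum_{i=1}^n\cos d_g(x_i,\alpha)$$ be the maximum likelihood estimator of $\alpha$ based on $n$ independent samples $x_1,\dots,x_n$ drawn from $f_{\mathrm{vMF}}(\cdot;\alpha^{\mathrm{tr}},\beta)$. Then for sufficiently large $n$, with probability at least $1-ce^{-cm\log^2n}$, $$d_g(\hat\alpha^{\mathrm{MLE}},\alpha^{\mathrm{tr}})\le\frac{Cm\log n}{\sqrt n}.$$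
   Context: $d_g$ is the geodesic distance and $\mathrm{dvol}$ the Riemannian volume measure on the unit sphere $\mathbb S^m$. The von Mises-Fisher density is $f_{\mathrm{vMF}}(x;\alpha,\beta)=\frac{1}{Z_{\mathrm{vMF}}(\beta)}e^{\beta\cos d_g(x,\alpha)}$, $Z_{\mathrm{vMF}}(\beta)=\int_{\mathbb S^m}e^{\beta\cos d_g(x,\alpha)}\,\mathrm{dvol}(x)$, with location parameter $\alpha\in\mathbb S^m$ and dispersion parameter $\beta>0$, assumed known. ''Sufficiently large $n$'' means $n\ge n_0$ for a threshold $n_0$ that may depend on the other parameters. *)

(* Defs.v *)
From HB Require Import structures.
From mathcomp Require Import all_boot all_order all_algebra.
From mathcomp Require Import all_classical all_reals all_analysis.
From mathcomp Require Import measurable_realfun.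

Set Implicit Arguments.
Unset Strict Implicit.
Unset Printing Implicit Defensive.

Import Order.TTheory GRing.Theory Num.Theory.
Import numFieldNormedType.Exports.

Local Open Scope classical_set_scope.
Local Open Scope ring_scope.

(* The library norm on 'rV is the sup norm, hence [dot] and [enorm]. *)
Definition dot (R : realType) (n : nat) (u v : 'rV[R]_n) : R :=
  \sum_(i < n) u ord0 i * v ord0 i.

Definition enorm (R : realType) (n : nat) (u : 'rV[R]_n) : R :=
  Num.sqrt (dot u u).

Section borel_rV.
Context {R : realType} {n : nat}.

Definition rV_coord (i : 'I_n) (u : 'rV[R]_n) : R := u ord0 i.

Let rV_set0 : g_sigma_preimage rV_coord set0.
Proof. exact: sigma_algebra0. Qed.

Let rV_setC A : g_sigma_preimage rV_coord A -> g_sigma_preimage rV_coord (~` A).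
Proof. exact: sigma_algebraC. Qed.

Let rV_bigcup (F : (set 'rV[R]_n)^nat) :
  (forall i, g_sigma_preimage rV_coord (F i)) ->
  g_sigma_preimage rV_coord (\bigcup_i (F i)).
Proof. exact: sigma_algebra_bigcup. Qed.

HB.instance Definition _ := @isMeasurable.Build default_measure_display
  'rV[R]_n (g_sigma_preimage rV_coord) rV_set0 rV_setC rV_bigcup.

Lemma measurable_rV_coord (i : 'I_n) :
  measurable_fun [set: 'rV[R]_n] (rV_coord i).
Proof.
move=> _ Y mY; rewrite setTI; apply: sub_sigma_algebra => /=.
rewrite -bigcup_seq/=; exists i => /=; first by rewrite mem_index_enum.
by exists Y => //; rewrite setTI.
Qed.

Lemma measurable_fun_rVP d (T : measurableType d) (f : T -> 'rV[R]_n) :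
  measurable_fun [set: T] f <->
  forall i, measurable_fun [set: T] (fun x => f x ord0 i).
Proof.
split=> [mf i|mf].
  exact: (measurableT_comp (measurable_rV_coord i) mf).
move=> _ A mA; rewrite setTI.
suff : g_sigma_preimage rV_coord `<=` [set B | measurable (f @^-1` B)].
  by apply.
apply: smallest_sub.
  split=> [|B /= mB|F /= mF].
  - by rewrite /= preimage_set0; exact: measurable0.
  - by rewrite setTD preimage_setC; exact: measurableC.
  - by rewrite preimage_bigcup; exact: bigcup_measurable.
rewrite -bigcup_seq/=; apply: bigcup_sub => i _ _ [B mB <-] /=.
rewrite setTI -comp_preimage -[X in measurable X]setTI.
exact: mf.
Qed.

End borel_rV.

Section lebesgue_rV.
Context {R : realType}.

Definition cons_rV (n : nat) (p : measurableTypeR R * 'rV[R]_n) : 'rV[R]_n.+1 :=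
  row_mx (const_mx p.1 : 'rV_1) p.2.

Lemma measurable_cons_rV (n : nat) : measurable_fun setT (@cons_rV n).
Proof.
apply/measurable_fun_rVP => i.
have [j ->|j ->] := @split_ordP 1 n i.
  rewrite (_ : (fun _ => _) = fst); first exact: measurable_fst.
  by apply/funext => p; rewrite [LHS](@row_mxEl _ 1 1 n) mxE.
rewrite (_ : (fun _ => _) = (rV_coord j) \o snd).
  exact: (measurableT_comp (measurable_rV_coord j) measurable_snd).
by apply/funext => p; exact: (@row_mxEr _ 1 1 n).
Qed.

Definition uncons_rV (n : nat) (u : 'rV[R]_n.+1) :
    measurableTypeR R * 'rV[R]_n :=
  (u ord0 ord0, rsubmx (u : 'rV_(1 + n))).

Lemma cons_rVK (n : nat) : cancel (@cons_rV n) (@uncons_rV n).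
Proof.
move=> [t u]; rewrite /uncons_rV /cons_rV row_mxKr; congr (_, _).
have -> : ord0 = lshift n (ord0 : 'I_1) :> 'I_(1 + n) by exact/val_inj.
by rewrite [LHS](@row_mxEl _ 1 1 n) mxE.
Qed.

Lemma measurable_uncons_rV (n : nat) : measurable_fun setT (@uncons_rV n).
Proof.
apply: measurable_fun_pair; first exact: (measurable_rV_coord ord0).
apply/measurable_fun_rVP => i.
rewrite (_ : (fun _ => _) = rV_coord (rshift 1 i : 'I_n.+1)).
  exact: measurable_rV_coord.
by apply/funext => u; rewrite mxE.
Qed.

Section cons_measure.
Context (n : nat) (mu : {sigma_finite_measure set 'rV[R]_n -> \bar R}).

Definition cons_measure : set 'rV[R]_n.+1 -> \bar R :=
  pushforward (@lebesgue_measure R \x mu)%E (@cons_rV n).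

Let cons_measurable (A : set 'rV[R]_n.+1) :
  measurable A -> measurable (@cons_rV n @^-1` A).
Proof.
by move=> mA; rewrite -[X in measurable X]setTI; exact: measurable_cons_rV.
Qed.

Let cons_measure0 : cons_measure set0 = 0%E.
Proof. by rewrite /cons_measure /pushforward preimage_set0 measure0. Qed.

Let cons_measure_ge0 A : (0 <= cons_measure A)%E.
Proof. by rewrite /cons_measure /pushforward; exact: measure_ge0. Qed.

Let cons_measure_additive : semi_sigma_additive cons_measure.
Proof.
move=> F mF tF mUF; rewrite /cons_measure /pushforward preimage_bigcup.
apply: measure_semi_sigma_additive.
- by move=> k; exact: cons_measurable.
- apply/trivIsetP => /= i j _ _ ij; rewrite -preimage_setI.
  by move/trivIsetP : tF => /(_ _ _ _ _ ij) ->//; rewrite preimage_set0.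
- by rewrite -preimage_bigcup; exact: cons_measurable.
Qed.

HB.instance Definition _ := isMeasure.Build _ _ _ cons_measure
  cons_measure0 cons_measure_ge0 cons_measure_additive.

Let cons_measure_sigma_finite : sigma_finite setT cons_measure.
Proof.
have /sigma_finiteP[F [TF ndF Foo]] := sigma_finiteT (@lebesgue_measure R).
have /sigma_finiteP[G [TG ndG Goo]] := sigma_finiteT mu.
exists (fun k => @uncons_rV n @^-1` (F k `*` G k)).
  rewrite -preimage_bigcup -[LHS](preimage_setT (@uncons_rV n)).
  congr (_ @^-1` _); rewrite -setXTT TF TG predeqE => -[x y]; split.
    move=> [/= [k _ Fkx] [l _ Gly]]; exists (maxn k l) => //; split.
    - by move: x Fkx; exact/subsetPset/ndF/leq_maxl.
    - by move: y Gly; exact/subsetPset/ndG/leq_maxr.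
  by move=> [k _ []/= ? ?]; split; exists k.
move=> k; have [? ?] := Foo k; have [? ?] := Goo k; split.
  rewrite -[X in measurable X]setTI; apply: measurable_uncons_rV => //.
  exact: measurableX.
rewrite /cons_measure /pushforward -comp_preimage.
rewrite (_ : _ \o _ = id); last by apply/funext => x; exact: cons_rVK.
by rewrite preimage_id product_measure1E// lte_mul_pinfty// ge0_fin_numE.
Qed.

HB.instance Definition _ := Measure_isSigmaFinite.Build _ _ _ cons_measure
  cons_measure_sigma_finite.

End cons_measure.

Fixpoint lebesgue_rV (n : nat) : {sigma_finite_measure set 'rV[R]_n -> \bar R} :=
  match n with
  | 0 => \d_(0 : 'rV[R]_0)
  | k.+1 => cons_measure (lebesgue_rV k)
  end.

End lebesgue_rV.
Arguments lebesgue_rV : clear implicits.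

Record sphere (R : realType) (m : nat) := Sphere {
  sphere_val :> 'rV[R]_m.+1;
  sphere_valP : enorm sphere_val == 1 }.

HB.instance Definition _ (R : realType) (m : nat) :=
  [isSub for @sphere_val R m].
HB.instance Definition _ (R : realType) (m : nat) :=
  [Choice of sphere R m by <:].

Section borel_sphere.
Context {R : realType} {m : nat}.

Lemma enorm_pole : enorm (delta_mx ord0 ord0 : 'rV[R]_m.+1) == 1.
Proof.
rewrite /enorm /dot (bigD1 ord0)//= big1 ?addr0 => [|i /negPf i0].
  by rewrite !mxE eqxx mulr1 sqrtr1.
by rewrite !mxE i0 andbF mulr0.
Qed.

HB.instance Definition _ := isPointed.Build (sphere R m) (Sphere enorm_pole).

Definition sphere_measurable : set (set (sphere R m)) :=
  preimage_set_system setT (@sphere_val R m) measurable.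

Let sphere_sigma_algebra : sigma_algebra setT sphere_measurable :=
  sigma_algebra_preimage setT (@sphere_val R m) (sigma_algebra_measurable _).

Let sphere_set0 : sphere_measurable set0.
Proof. by case: sphere_sigma_algebra. Qed.

Let sphere_setC A : sphere_measurable A -> sphere_measurable (~` A).
Proof. by case: sphere_sigma_algebra => _ + _ => /[apply]; rewrite setTD. Qed.

Let sphere_bigcup (F : (set (sphere R m))^nat) :
  (forall i, sphere_measurable (F i)) -> sphere_measurable (\bigcup_i (F i)).
Proof. by case: sphere_sigma_algebra => _ _; apply. Qed.

HB.instance Definition _ := @isMeasurable.Build default_measure_display
  (sphere R m) sphere_measurable sphere_set0 sphere_setC sphere_bigcup.

Lemma measurable_fun_sphereP d (T : measurableType d) (f : T -> sphere R m) :
  measurable_fun [set: T] f <->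
  measurable_fun [set: T] (fun x => sphere_val (f x)).
Proof.
split=> mf _ A.
  by move=> mA; rewrite setTI; have := mf measurableT (@sphere_val R m @^-1` A);
    rewrite setTI; apply; exists A => //; rewrite setTI.
by move=> [B mB <-]; rewrite setTI; have := mf measurableT _ mB; rewrite !setTI.
Qed.

End borel_sphere.

(* The Riemannian metric is the one induced by the ambient Euclidean space, so
   the speed of a curve is the Euclidean norm of its derivative. *)
Section geodesic_distance.
Context {R : realType} {m : nat}.

(* Only the restriction of the curve to [0, 1] matters; asking for regularity
   on all of R loses no curve, since a C^1 curve on [0, 1] can be continued
   along great circles with the end velocities. *)
Definition C1_curve (g : R -> sphere R m) : Prop :=
  (forall t, derivable (fun s => sphere_val (g s)) t 1) /\
  continuous (derive1 (fun s => sphere_val (g s))).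

Definition curve_length (g : R -> sphere R m) : R :=
  \int[lebesgue_measure]_(t in `[0, 1])
     enorm (derive1 (fun s => sphere_val (g s)) t).

(* For m = 0 antipodal points are joined by no curve, and [inf] of the empty
   set is 0: only meaningful for 0 < m. *)
Definition geodesic_dist (x y : sphere R m) : R :=
  inf [set curve_length g | g in
    [set g | [/\ C1_curve g, g 0 = x & g 1 = y]]].

End geodesic_distance.

(* [jacobian] acts on row vectors: its i-th row is the i-th partial derivative
   of phi, so the determinant is that of the Gram matrix of the metric induced
   in the chart. *)
Definition volume_density (R : realType) (m k : nat)
    (phi : 'rV[R]_m -> 'rV[R]_k) (z : 'rV[R]_m) : R :=
  Num.sqrt (\det (jacobian phi z *m (jacobian phi z)^T)).

Section volume_density_measurable.
Context {R : realType} {m k : nat}.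
Variable phi : 'rV[R]_m -> 'rV[R]_k.
Hypothesis mphi : measurable_fun setT phi.
Hypothesis dphi : forall z, differentiable phi z.

Let measurable_addl (v : 'rV[R]_m) :
  measurable_fun [set: 'rV[R]_m] (fun z : 'rV[R]_m => v + z).
Proof.
apply/measurable_fun_rVP => i; under eq_fun do rewrite mxE.
exact: measurable_funD (measurable_cst _) (measurable_rV_coord i).
Qed.

Let jacobian_measurable i j :
  measurable_fun setT (fun z => jacobian phi z i j).
Proof.
pose v : 'rV[R]_m := delta_mx ord0 i.
pose q (l : nat) (z : 'rV[R]_m) : R :=
  l.+1%:R * (phi (l.+1%:R^-1 *: v + z) ord0 j - phi z ord0 j).
apply: (@measurable_realfun.measurable_fun_cvg _ _ _ _ q) => [l|z _].
  apply: measurable_funM; first exact: measurable_cst.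
  apply: measurable_funB.
    apply: (measurable_fun_rVP (fun z => phi (l.+1%:R^-1 *: v + z))).1.
    exact: (measurableT_comp mphi (measurable_addl _)).
  exact: ((measurable_fun_rVP phi).1 mphi j).
have -> : jacobian phi z i j = ('D_v phi z) ord0 j.
  by rewrite deriveEjacobian// -rowE [RHS]mxE.
have := diff_derivable (v := v) (dphi z); rewrite /derivable => dv.
have {}dv : h^-1 *: (phi (h *: v + z) - phi z) @[h --> 0^'] --> 'D_v phi z.
  exact: dv.
have hinv : (fun l : nat => l.+1%:R^-1 : R) @ \oo --> 0^'.
  move=> A; rewrite /= /dnbhs /within /= => /(@cvg_harmonic R) nA.
  have {nA} : \forall l \near \oo, (@harmonic R l) != 0 -> A (@harmonic R l).
    exact: nA.
  by apply: filterS => l; apply; exact: (lt0r_neq0 (harmonic_gt0 l)).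
have := cvg_comp _ _ hinv dv => dv'.
have := cvg_comp _ _ dv' (@coord_continuous _ _ _ ord0 j _).
apply: cvg_trans; apply: near_eq_cvg; near=> l.
by rewrite /q /= !mxE invrK.
Unshelve. all: by end_near. Qed.

Lemma measurable_volume_density : measurable_fun setT (volume_density phi).
Proof.
apply: measurableT_comp.
  by apply: continuous_measurable_fun; exact: sqrt_continuous.
rewrite /determinant; apply: measurable_sum => s.
apply: measurable_funM; first exact: measurable_cst.
apply: measurable_prod => i _; under eq_fun do rewrite mxE.
apply: measurable_sum => j; apply: measurable_funM.
  exact: jacobian_measurable.
by under eq_fun do rewrite mxE; exact: jacobian_measurable.
Qed.

End volume_density_measurable.

Section volume.
Context {R : realType} {m : nat}.

(* Central projection of the hyperplanes {x_0 = 1} and {x_0 = -1}: two charts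
   covering the sphere up to the equator {x_0 = 0}, a null set. *)
Definition gnomonic (b : bool) (z : 'rV[R]_m) : 'rV[R]_m.+1 :=
  let v := cons_rV ((-1) ^+ b, z) in (enorm v)^-1 *: v.

Let dot_cons (t : R) (z : 'rV[R]_m) :
  dot (cons_rV (t, z)) (cons_rV (t, z)) = t ^+ 2 + dot z z.
Proof.
rewrite /dot (@big_split_ord _ _ _ 1 m) big_ord1 /=.
by congr (_ + _); [|apply: eq_bigr => i _]; rewrite ?(@row_mxEl _ 1 1 m)
  ?(@row_mxEr _ 1 1 m) ?mxE -?expr2.
Qed.

Let dot_lift (b : bool) (z : 'rV[R]_m) :
  dot (cons_rV ((-1) ^+ b, z)) (cons_rV ((-1) ^+ b, z)) = 1 + dot z z.
Proof. by rewrite dot_cons sqrr_sign. Qed.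

Let dot_lift_gt0 (z : 'rV[R]_m) : 0 < 1 + dot z z.
Proof.
by rewrite ltr_pwDl// sumr_ge0// => i _; rewrite -expr2 sqr_ge0.
Qed.

Lemma enorm_gnomonic (b : bool) (z : 'rV[R]_m) : enorm (gnomonic b z) == 1.
Proof.
rewrite /gnomonic; set v := cons_rV _.
have vE : dot v v = 1 + dot z z by exact: dot_lift.
have E a : dot (a *: v) (a *: v) = a ^+ 2 * dot v v.
  rewrite /dot mulr_sumr; apply: eq_bigr => i _.
  by rewrite !mxE mulrACA -expr2.
rewrite {1}/enorm E exprVn /enorm sqr_sqrtr vE ?(ltW (dot_lift_gt0 z))//.
by rewrite mulVf ?sqrtr1// gt_eqF.
Qed.

Definition gnomonic_chart (b : bool) (z : 'rV[R]_m) : sphere R m :=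
  Sphere (enorm_gnomonic b z).

Let coord_lift (b : bool) (z : 'rV[R]_m) (i : 'I_m.+1) :
  {c | forall z : 'rV[R]_m, cons_rV ((-1) ^+ b, z) ord0 i = c} +
  {j | forall z : 'rV[R]_m, cons_rV ((-1) ^+ b, z) ord0 i = z ord0 j}.
Proof.
case: (split_ordP (i : 'I_(1 + m))) => [j ->|j ->]; [left|right].
  by exists ((-1) ^+ b) => u; rewrite [LHS](@row_mxEl _ 1 1 m) mxE.
by exists j => u; rewrite [LHS](@row_mxEr _ 1 1 m).
Qed.

Lemma measurable_gnomonic (b : bool) : measurable_fun setT (gnomonic b).
Proof.
apply/measurable_fun_rVP => i; rewrite /gnomonic; under eq_fun do rewrite mxE.
apply: measurable_funM.
  rewrite (_ : (fun _ => _) =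
      (@powR R)^~ (- 2^-1) \o (fun z : 'rV[R]_m => 1 + dot z z)).
    apply: measurableT_comp; first exact: measurable_powR.
    apply: measurable_funD; first exact: measurable_cst.
    apply: measurable_sum => j.
    by apply: measurable_funM; exact: (measurable_rV_coord j).
  apply/funext => z /=; rewrite powRN powR12_sqrt ?(ltW (dot_lift_gt0 z))//.
  by rewrite /enorm dot_lift.
case: (coord_lift b 0 i) => [[c cE]|[j jE]].
  by under eq_fun do rewrite cE; exact: measurable_cst.
by under eq_fun do rewrite jE; exact: (measurable_rV_coord j).
Qed.

Lemma differentiable_gnomonic (b : bool) (z : 'rV[R]_m) :
  differentiable (gnomonic b) z.
Proof.
rewrite (_ : gnomonic b = \sum_(i < m.+1)
    (fun z => gnomonic b z ord0 i *: (delta_mx ord0 i : 'rV[R]_m.+1))); last first.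
  by apply/funext => u; rewrite fct_sumE -row_sum_delta.
apply: differentiable_sum => i; apply: differentiableZl.
rewrite (_ : (fun _ => _) = (fun u => (Num.sqrt (1 + dot u u))^-1) *
    (fun u => cons_rV ((-1) ^+ b, u) ord0 i)); last first.
  by apply/funext => u; rewrite /gnomonic mxE /enorm dot_lift.
apply: differentiableM; last first.
  case: (coord_lift b 0 i) => [[c cE]|[j jE]].
    by under eq_fun do rewrite cE; exact: differentiable_cst.
  by under eq_fun do rewrite jE; exact: differentiable_coord.
apply: differentiableV; last by rewrite gt_eqF// sqrtr_gt0.
apply: (@differentiable_comp _ _ _ _ (fun u => 1 + dot u u) Num.sqrt).
  apply: differentiableD; first exact: differentiable_cst.
  rewrite (_ : (fun u => dot u u) = \sum_(j < m)
      (fun u : 'rV[R]_m => u ord0 j * u ord0 j)); last first.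
    by apply/funext => u; rewrite fct_sumE.
  apply: differentiable_sum => j.
  by apply: differentiableM; exact: differentiable_coord.
apply/derivable1_diffP.
by have [] := is_derive1_sqrt (dot_lift_gt0 z).
Qed.

Lemma measurable_gnomonic_chart (b : bool) :
  measurable_fun setT (gnomonic_chart b).
Proof. by apply/measurable_fun_sphereP; exact: measurable_gnomonic. Qed.

Definition sphere_vol (A : set (sphere R m)) : \bar R :=
  (\sum_(b : bool) \int[lebesgue_rV R m]_(z in gnomonic_chart b @^-1` A)
     (volume_density (gnomonic b) z)%:E)%E.

Let chart_measurable b (A : set (sphere R m)) :
  measurable A -> measurable (gnomonic_chart b @^-1` A).
Proof.
move=> mA; rewrite -[X in measurable X]setTI.
exact: measurable_gnomonic_chart.
Qed.

Let sphere_vol0 : sphere_vol set0 = 0%E.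
Proof.
by rewrite /sphere_vol big1// => b _; rewrite preimage_set0 integral_set0.
Qed.

Let sphere_vol_ge0 A : (0 <= sphere_vol A)%E.
Proof.
apply: sume_ge0 => b _; apply: integral_ge0 => z _.
by rewrite lee_fin sqrtr_ge0.
Qed.

Let sphere_vol_additive : semi_sigma_additive sphere_vol.
Proof.
move=> F mF tF mUF.
have -> : sphere_vol (\bigcup_n F n) = (\sum_(n <oo) sphere_vol (F n))%E.
  rewrite /sphere_vol nneseries_sum; last first.
    by move=> b n _; apply: integral_ge0 => z _; rewrite lee_fin sqrtr_ge0.
  apply: eq_bigr => b _; rewrite preimage_bigcup ge0_integral_bigcup//.
  - by move=> n; exact: chart_measurable.
  - apply: measurable_funTS; apply/measurable_EFinP.
    apply: measurable_volume_density; first exact: measurable_gnomonic.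
    exact: differentiable_gnomonic.
  - by move=> z _; rewrite lee_fin sqrtr_ge0.
  - apply/trivIsetP => /= i j _ _ ij; rewrite -preimage_setI.
    by move/trivIsetP : tF => /(_ _ _ _ _ ij) ->//; rewrite preimage_set0.
by apply: is_cvg_nneseries => n _ _; exact: sphere_vol_ge0.
Qed.

HB.instance Definition _ := isMeasure.Build _ _ _ sphere_vol
  sphere_vol0 sphere_vol_ge0 sphere_vol_additive.

End volume.

Section von_Mises_Fisher.
Context {R : realType} {m : nat}.

(* By rotation invariance of the volume this does not depend on [alpha]. *)
Definition vMF_Z (alpha : sphere R m) (beta : R) : R :=
  \int[sphere_vol]_(x in setT) expR (beta * cos (geodesic_dist x alpha)).

Definition vMF_density (x alpha : sphere R m) (beta : R) : R :=
  expR (beta * cos (geodesic_dist x alpha)) / vMF_Z alpha beta.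

Definition argmax (f : sphere R m -> R) : set (sphere R m) :=
  [set a | forall b, f b <= f a].

(* A set, since the maximizer is not unique when the samples sum to 0. *)
Definition vMF_MLE (n : nat) (x : 'I_n -> sphere R m) : set (sphere R m) :=
  argmax (fun alpha => \sum_(i < n) cos (geodesic_dist (x i) alpha)).

End von_Mises_Fisher.

Section probability.
Context {R : realType} {d d' : measure_display}.
Context {Omega : measurableType d} {T : measurableType d'}.
Variable P : probability Omega R.

Definition mutually_independent (n : nat) (X : 'I_n -> {RV P >-> T}) : Prop :=
  forall (J : {set 'I_n}) (B : 'I_n -> set T),
    (forall i, measurable (B i)) ->
    P (\bigcap_(i in [set` J]) X i @^-1` B i) =
    (\prod_(i in J) P (X i @^-1` B i))%E.

Definition has_density (X : {RV P >-> T}) (mu : {measure set T -> \bar R})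
    (f : T -> R) : Prop :=
  forall A, measurable A -> distribution P X A = (\int[mu]_(x in A) (f x)%:E)%E.

(* Inner probability, as A need not be known to be measurable. *)
Definition with_probability_ge (p : R) (A : set Omega) : Prop :=
  exists2 E, measurable E /\ E `<=` A & (p%:E <= P E)%E.

End probability.

(* Main.v *)
Require Import Defs.
From mathcomp Require Import all_boot all_order all_algebra.
From mathcomp Require Import all_classical all_reals all_analysis.
From mathcomp Require Import measurable_realfun ring lra.

Set Implicit Arguments.
Unset Strict Implicit.
Unset Printing Implicit Defensive.

Import Order.TTheory GRing.Theory Num.Theory.
Import numFieldNormedType.Exports.

Local Open Scope classical_set_scope.
Local Open Scope ring_scope.

(** Write S for the sum of the samples x_1, ..., x_n.  Since the cosine of the
    geodesic distance is the Euclidean inner product ([cos_geodesic_dist]), the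
    log-likelihood at a is, up to constants, <S, a>, and the estimator is
    S / |S|.  The angle t between it and the pole alpha satisfies
    tan t = |S'| / <S, alpha>, where S' is the part of S orthogonal to alpha.
    So the theorem amounts to a lower bound on <S, alpha> and an upper bound on
    |S'| ([acos_argmax_le]).

    Two facts about one sample x carry the dependence on the dimension.
    - The pole: E exp(- (beta / 2) <x, alpha>) <= 1 - (beta / 2) kappa with
      kappa = (beta / 4) exp(- beta) / (m + 1) ([vMF_pole_mgf]).  By Chernoff,
      <S, alpha> > n kappa / 2 up to a probability exponentially small in n.
    - The orthogonal directions: for u orthogonal to alpha the law of <x, u> is
      symmetric, and its variance is the same for all such unit vectors u,
      hence at most 1 / m ([vMF_orthogonal_variance]); so the moment generating
      function of <x, u> at l is at most 1 + 2 l^2 |u|^2 / m for small l.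
      With s = ln n / sqrt n, Chernoff at l = m s / 16 bounds the probability
      of <S, u> >= n s by exp(- m (ln n)^2 / 32).  This choice of l is small
      enough because m is fixed while s tends to 0.
    A finite net of directions turns the second bound into |S'| <= 2 n s: its
    cardinal depends on m only, and so is absorbed by halving the exponent when
    n is large.  Altogether the angle is at most 4 s / kappa, which is
    O(m ln n / sqrt n).

    Both facts use the geometry of the sphere only through the invariance of
    the volume under reflections in hyperplanes.  As the volume is given by
    charts, it is first rewritten as the integral of |y|^(- m) over the part of
    the unit ball of R^(m+1) that lies on the rays through the set
    ([sphere_vol_cone]); this leaves the invariance of Lebesgue measure under
    linear involutions, which is the uniqueness argument for Haar measure
    ([lebesgue_rV_involution]). *)

(** * Image measures with a density *)

Definition image_measure d1 d2 (T1 : measurableType d1) (T2 : measurableType d2)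
    (R : realType) (mu : {measure set T1 -> \bar R}) (phi : T1 -> T2)
    (mphi : measurable_fun setT phi) : {measure set T2 -> \bar R}.
Proof. by refine (pushforward mu phi : {measure set T2 -> \bar R}). Defined.

Lemma ge0_integral_image_measure d1 d2 (T1 : measurableType d1)
    (T2 : measurableType d2) (R : realType) (mu : {measure set T1 -> \bar R})
    (phi : T1 -> T2) (mphi : measurable_fun setT phi) (f : T2 -> \bar R) :
  measurable_fun setT f -> (forall y, 0 <= f y)%E ->
  (\int[image_measure mu mphi]_y f y = \int[mu]_x f (phi x))%E.
Proof. by move=> mf f0; rewrite ge0_integral_pushforward. Qed.

Section image_density.
Local Open Scope ereal_scope.
Context {R : realType} d1 d2 (X : measurableType d1) (Y : measurableType d2).
Variables (mu : {measure set X -> \bar R}) (phi : X -> Y) (w : X -> R).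
Hypotheses (mphi : measurable_fun setT phi) (mw : measurable_fun setT w).
Hypothesis w0 : forall x, (0 <= w x)%R.
Variable nu : {measure set Y -> \bar R}.
Hypothesis nuE : forall B, measurable B ->
  nu B = \int[mu]_(x in phi @^-1` B) (w x)%:E.

Import HBNNSimple.

(** This covers at once the two situations met below: a law given by a density
    ([phi] is the identity), and the conditional weight of the other samples
    seen through one sample ([phi] is the sample).  Both sides are monotone
    limits along simple functions, for which it is the hypothesis on [nu]. *)
Lemma integral_image_density (f : Y -> \bar R) :
  measurable_fun setT f -> (forall y, 0 <= f y) ->
  \int[nu]_y f y = \int[mu]_x (f (phi x) * (w x)%:E).
Proof.
move=> mf f0; pose f_ := nnsfun_approx measurableT mf.
have mpre (B : set Y) : measurable B -> measurable (phi @^-1` B).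
  by move=> mB; rewrite -[X in measurable X]setTI; exact: mphi.
transitivity (limn (fun n => \int[nu]_y (f_ n y)%:E)).
  rewrite -monotone_convergence//.
  - apply: eq_integral => y _; apply/esym/cvg_lim => //.
    by apply: cvg_nnsfun_approx=> // *; exact: f0.
  - by move=> n; exact/measurable_EFinP/measurable_funP.
  - by move=> n y _; rewrite lee_fin.
  - by move=> y _ m n mn; rewrite lee_fin; exact/lefP/nd_nnsfun_approx.
transitivity (limn (fun n => \int[mu]_x ((f_ n (phi x))%:E * (w x)%:E))); last first.
  rewrite -monotone_convergence//.
  - apply: eq_integral => x _; apply/cvg_lim => //.
    apply: cvgeZr => //; apply: cvg_nnsfun_approx=> // *; exact: f0.
  - move=> n; apply: emeasurable_funM; last exact/measurable_EFinP.
    apply/measurable_EFinP; apply: measurableT_comp mphi.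
    exact: measurable_funP.
  - by move=> n x _; rewrite mule_ge0 ?lee_fin.
  - move=> x _ m n mn; apply: lee_wpmul2r; rewrite lee_fin//.
    exact/lefP/nd_nnsfun_approx.
congr (limn _); apply/funext => n.
transitivity (\sum_(k \in range (f_ n)) (k%:E * nu (f_ n @^-1` [set k]))).
  under eq_integral do rewrite fimfunE -fsumEFin//.
  rewrite ge0_integral_fsum//.
  - by apply: eq_fsbigr => r _; rewrite integralZl_indic_nnsfun// integral_indic//= setIT.
  - by move=> y; exact/measurable_EFinP/measurable_funM.
  - by move=> y x _; rewrite nnfun_muleindic_ge0.
have mA k : measurable (phi @^-1` (f_ n @^-1` [set k])) by exact: mpre.
transitivity (\int[mu]_x (\sum_(k \in range (f_ n))
    (k * \1_(phi @^-1` (f_ n @^-1` [set k])) x * w x)%:E)); last first.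
  apply: eq_integral => x _; rewrite fsumEFin// -EFinM; congr EFin.
  by rewrite [in RHS]fimfunE mulrC mulr_fsumr; apply: eq_fsbigr => k _; rewrite mulrC.
rewrite ge0_integral_fsum//.
- apply: eq_fsbigr => r; rewrite inE/= => -[y _ fy].
  rewrite nuE// integral_mkcond.
  rewrite -ge0_integralZl//; last 3 first.
  + apply/(measurable_restrictT _ _).1 => //.
    by apply: measurable_funTS; exact/measurable_EFinP.
  + by move=> x _; rewrite patchE; case: ifP => // _; rewrite lee_fin.
  + by rewrite lee_fin -fy.
  apply: eq_integral => x _; rewrite patchE indicE.
  by case: ifP => _; rewrite ?mulr1 ?mulr0 ?mul0r ?mule0.
- move=> y; apply/measurable_EFinP; apply: measurable_funM => //.
  by apply: measurable_funM => //; exact: measurable_indic.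
- move=> y x _; rewrite lee_fin mulr_ge0//.
  have := nnfun_muleindic_ge0 (f_ n) y (phi x); rewrite lee_fin.
  by rewrite !indicE.
Qed.

End image_density.

(** * Lebesgue measure on row vectors *)

Section lebesgue_rV_theory.
Context {R : realType}.
Local Open Scope ereal_scope.
Notation leb := (@lebesgue_measure R).

Lemma lebesgue_affine (a b : R) (f : R -> \bar R) : (0 < a)%R ->
  measurable_fun [set: measurableTypeR R] f -> (forall t, 0 <= f t) ->
  a%:E * \int[leb]_t f (a * t + b)%R = \int[leb]_t f t.
Proof.
move=> a0 mf f0.
pose phi (t : measurableTypeR R) : measurableTypeR R := (a * t + b)%R.
have mphi : measurable_fun setT phi.
  by apply: measurable_funD => //; exact: mulrl_measurable.
have a0' : (0 <= a)%R by exact: ltW.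
pose nu : {measure set (measurableTypeR R) -> \bar R} :=
  mscale (NngNum a0') (image_measure leb mphi).
transitivity (\int[nu]_t f t).
  by rewrite ge0_integral_mscale//= ge0_integral_image_measure.
apply: eq_measure_integral => A mA _; symmetry.
apply: lebesgue_measure_unique => // _ [[x y]] _ <-.
rewrite /= /mscale/= /pushforward.
pose x' := ((x - b) / a)%R; pose y' := ((y - b) / a)%R.
have -> : phi @^-1` `]x, y] = `]x', y']%classic.
  apply/seteqP; split => t /=; rewrite !in_itv/= /x' /y' ltr_pdivrMr// ler_pdivlMr//;
    by rewrite /phi ltrBlDr lerBrDr mulrC.
rewrite !lebesgue_measure_itv/= !lte_fin /x' /y' ltr_pM2r ?invr_gt0// ltrD2r.
case: ifPn => _; last by rewrite mule0.
by rewrite -!EFinD -EFinM; congr EFin; field; rewrite gt_eqF.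
Qed.

Lemma integral_lebesgue_rVS (n : nat) (f : 'rV[R]_n.+1 -> \bar R) :
  measurable_fun setT f -> (forall y, 0 <= f y) ->
  \int[lebesgue_rV R n.+1]_y f y =
  \int[leb]_t \int[lebesgue_rV R n]_u f (cons_rV (t, u)).
Proof.
move=> mf f0; have mc := @measurable_cons_rV R n.
rewrite [LHS](_ : _ = \int[image_measure (leb \x lebesgue_rV R n) mc]_y f y) //.
rewrite (ge0_integral_image_measure (leb \x lebesgue_rV R n) mc)//= (fubini_tonelli1 (f \o @cons_rV R n))//.
  exact: measurableT_comp.
by move=> p; exact: f0.
Qed.

Lemma measurable_rVD d (T : measurableType d) n (f g : T -> 'rV[R]_n) :
  measurable_fun setT f -> measurable_fun setT g ->
  measurable_fun setT (fun x => f x + g x)%R.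
Proof.
move=> /measurable_fun_rVP mf /measurable_fun_rVP mg; apply/measurable_fun_rVP => i.
by under eq_fun do rewrite mxE; exact: measurable_funD.
Qed.

Lemma measurable_rVZ d (T : measurableType d) n (c : T -> R) (f : T -> 'rV[R]_n) :
  measurable_fun setT c -> measurable_fun setT f ->
  measurable_fun setT (fun x => c x *: f x)%R.
Proof.
move=> mc /measurable_fun_rVP mf; apply/measurable_fun_rVP => i.
by under eq_fun do rewrite mxE; exact: measurable_funM.
Qed.

Lemma cons_rVl n (p : R * 'rV[R]_n) (j : 'I_1) : cons_rV p ord0 (lshift n j) = p.1.
Proof. by rewrite [LHS](@row_mxEl _ 1 1 n) mxE. Qed.

Lemma cons_rVr n (p : R * 'rV[R]_n) (j : 'I_n) : cons_rV p ord0 (rshift 1 j) = p.2 ord0 j.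
Proof. by rewrite [LHS](@row_mxEr _ 1 1 n). Qed.

Lemma cons_rVP n (u v : 'rV[R]_n.+1) :
  (forall j : 'I_1, u ord0 (lshift n j) = v ord0 (lshift n j)) ->
  (forall j : 'I_n, u ord0 (rshift 1 j) = v ord0 (rshift 1 j)) -> u = v.
Proof.
move=> h1 h2; apply/rowP => i.
by case: (split_ordP (i : 'I_(1 + n))) => j ->; [exact: h1|exact: h2].
Qed.

Lemma cons_rVD n (s t : R) (u v : 'rV[R]_n) :
  (cons_rV (s, u) + cons_rV (t, v) = cons_rV (s + t, u + v))%R.
Proof. by apply: cons_rVP => j; rewrite mxE !(cons_rVl, cons_rVr)//= mxE. Qed.

Lemma cons_rVZ n (s t : R) (u : 'rV[R]_n) :
  (s *: cons_rV (t, u) = cons_rV (s * t, s *: u))%R.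
Proof. by apply: cons_rVP => j; rewrite mxE !(cons_rVl, cons_rVr)//= mxE. Qed.

Lemma uncons_rVK n : cancel (@uncons_rV R n) (@cons_rV R n).
Proof.
move=> u; apply: cons_rVP => j; rewrite !(cons_rVl, cons_rVr)//=.
  by congr (u _ _); apply/val_inj; rewrite /= ord1.
by rewrite mxE.
Qed.

(** By induction on the dimension from the case of the line, one coordinate
    being split off by Tonelli. *)
Lemma lebesgue_rV_affine (n : nat) (a : R) (v : 'rV[R]_n) (f : 'rV[R]_n -> \bar R) :
  (0 < a)%R -> measurable_fun setT f -> (forall y, 0 <= f y) ->
  (a ^+ n)%:E * \int[lebesgue_rV R n]_y f (a *: y + v)%R = \int[lebesgue_rV R n]_y f y.
Proof.
move=> a0; elim: n v f => [v f mf f0|n IH v f mf f0].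
  by rewrite expr0 mul1e; apply: eq_integral => y _; congr f; apply/rowP => -[].
have maff m (w : 'rV[R]_m) : measurable_fun setT (fun y : 'rV[R]_m => a *: y + w)%R.
  apply: (@measurable_rVD _ _ _ (fun y : 'rV[R]_m => a *: y)%R (cst w)) => //.
  exact: (@measurable_rVZ _ _ _ (cst a) id).
rewrite !integral_lebesgue_rVS//.
have -> : (f = fun y => f y) by [].
rewrite -(uncons_rVK v); case: (uncons_rV v) => b w.
have mfc : measurable_fun setT (f \o @cons_rV R n).
  exact: (measurableT_comp mf (@measurable_cons_rV R n)).
have mfb t : measurable_fun setT (fun u : 'rV[R]_n => f (cons_rV (t, u))).
  exact: (measurableT_comp mfc (pair1_measurable t)).
under eq_integral do under eq_integral do rewrite cons_rVZ cons_rVD.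
transitivity (a%:E * \int[leb]_t ((a ^+ n)%:E *
    \int[lebesgue_rV R n]_u f (cons_rV (a * t + b, a *: u + w)%R))).
  rewrite ge0_integralZl//.
  - by rewrite muleA -EFinM exprS.
  - pose g (p : measurableTypeR R * 'rV[R]_n) := f (cons_rV (a * p.1 + b, a *: p.2 + w)%R).
    apply: (@measurable_fun_fubini_tonelli_F _ _ _ _ R (lebesgue_rV R n) g) => //.
    apply: (measurableT_comp mfc); apply: measurable_fun_pair => //=.
      by apply: measurable_funD => //; apply: measurable_funM => //; exact: measurable_fst.
    apply: (@measurable_rVD _ _ _ (fun p : measurableTypeR R * 'rV[R]_n => a *: p.2)%R (cst w)) => //.
    by apply: (@measurable_rVZ _ _ _ (cst a) snd) => //; exact: measurable_snd.
    by move=> p; exact: f0.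
  - by move=> t _; exact: integral_ge0.
  - by rewrite lee_fin exprn_ge0// ltW.
transitivity (a%:E * \int[leb]_t \int[lebesgue_rV R n]_u f (cons_rV (a * t + b, u)%R)).
  congr (_ * _); apply: eq_integral => t _.
  exact: (IH w (fun u => f (cons_rV (a * t + b, u)%R))).
apply: (lebesgue_affine b (f := fun t => \int[lebesgue_rV R n]_y f (cons_rV (t, y)))) => //.
    apply: (@measurable_fun_fubini_tonelli_F _ _ _ _ R (lebesgue_rV R n) (f \o @cons_rV R n)) => //.
    by move=> p; exact: f0.
  by move=> t; exact: integral_ge0.
by apply: (measurableT_comp mf); exact: maff.
Qed.

Definition unit_cube n : set 'rV[R]_n := [set u | forall i, u ord0 i \in `[0, 1]%R].

Arguments unit_cube : clear implicits.

Lemma measurable_unit_cube n : measurable (unit_cube n).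
Proof.
rewrite (_ : unit_cube n = \bigcap_(i in [set: 'I_n]) ((@rV_coord R n i) @^-1` `[0%R, 1%R]%classic)).
  apply: fin_bigcap_measurable => // i _; rewrite -[X in measurable X]setTI.
  exact: measurable_rV_coord.
by apply/seteqP; split => u /= h i //; [move=> _; exact: h|exact: (h i Logic.I)].
Qed.

Lemma lebesgue_unit_cube n : lebesgue_rV R n (unit_cube n) = 1.
Proof.
elim: n => [|n IH]; first by rewrite /= diracE mem_set// => -[].
rewrite [LHS](_ : _ = (leb \x lebesgue_rV R n) (@cons_rV R n @^-1` unit_cube n.+1)) //.
have -> : @cons_rV R n @^-1` unit_cube n.+1 = `[0%R, 1%R]%classic `*` unit_cube n.
  apply/seteqP; split => [[t u] /= h|[t u] /= [ht hu] i].
    split => [|i].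
      have := h ord0; have -> : ord0 = lshift n (ord0 : 'I_1) :> 'I_(1 + n) by exact/val_inj.
      by rewrite cons_rVl.
    by have := h (rshift 1 i : 'I_n.+1); rewrite cons_rVr.
  case: (split_ordP (i : 'I_(1 + n))) => j ->.
    by rewrite cons_rVl.
  by rewrite cons_rVr.
rewrite product_measure1E//; last exact: measurable_unit_cube.
rewrite [X in _ * X]IH mule1.
have : leb `[0%R, 1%R]%classic = 1 by rewrite lebesgue_measure_itv/= lte_fin ltr01 sube0.
by [].
Qed.

Lemma lebesgue_rV_transl n (v : 'rV[R]_n) (f : 'rV[R]_n -> \bar R) :
  measurable_fun setT f -> (forall y, 0 <= f y) ->
  \int[lebesgue_rV R n]_y f (y + v)%R = \int[lebesgue_rV R n]_y f y.
Proof.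
move=> mf f0; rewrite -(lebesgue_rV_affine v (ltr01 : (0 < 1 :> R)%R) mf f0).
by rewrite expr1n mul1e; apply: eq_integral => y _; rewrite scale1r.
Qed.


Section linear_involution.
Variable n : nat.
Notation L := (lebesgue_rV R n).

(** The uniqueness argument for invariant measures: in the double integral of
    f (H x) g (y) translate y by H x, exchange the integrals, translate x by
    - H y, and exchange again.  With [g] the indicator of a set of measure 1 it
    shows that the image of Lebesgue measure under H is a multiple of it. *)
Lemma additive_involution_swap (H : 'rV[R]_n -> 'rV[R]_n)
    (f g : 'rV[R]_n -> \bar R) :
  measurable_fun setT H -> involutive H ->
  (forall x y, H (x + y) = H x + H y)%R ->
  measurable_fun setT f -> (forall y, 0 <= f y) ->
  measurable_fun setT g -> (forall y, 0 <= g y) ->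
  (\int[L]_x f (H x)) * (\int[L]_y g y) =
  (\int[L]_x g (H x)) * (\int[L]_y f (- y)%R).
Proof.
move=> mH HK HD mf f0 mg g0.
have HB x y : H (x - H y)%R = (H x - y)%R.
  by apply/eqP; rewrite eq_sym subr_eq -{2}[y]HK -HD subrK.
have mfH : measurable_fun setT (fun x => f (H x)) by exact: measurableT_comp.
have mgH : measurable_fun setT (fun x => g (H x)) by exact: measurableT_comp.
have mN : measurable_fun setT (fun y : 'rV[R]_n => - y)%R.
  apply/measurable_fun_rVP => i; under eq_fun do rewrite mxE.
  by apply: measurable_funN; exact: (measurable_rV_coord i).
have mfN : measurable_fun setT (fun y : 'rV[R]_n => f (- y)%R) by exact: measurableT_comp.
have mH1 : measurable_fun setT (fun p : 'rV[R]_n * 'rV[R]_n => H p.1).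
  exact: (measurableT_comp mH measurable_fst).
pose h1 (p : 'rV[R]_n * 'rV[R]_n) := f (H p.1) * g (p.2 + H p.1)%R.
have mh1 : measurable_fun setT h1.
  apply: emeasurable_funM; first exact: (measurableT_comp mf mH1).
  apply: (measurableT_comp mg); apply: measurable_rVD => //; exact: measurable_snd.
pose h2 (p : 'rV[R]_n * 'rV[R]_n) := f (H p.1 - p.2)%R * g (H p.1).
have mh2 : measurable_fun setT h2.
  apply: emeasurable_funM; last exact: (measurableT_comp mg mH1).
  apply: (measurableT_comp mf).
  apply: (@measurable_rVD _ _ _ (fun p : 'rV[R]_n * 'rV[R]_n => H p.1) (fun p : 'rV[R]_n * 'rV[R]_n => - p.2)%R) => //.
  exact: (measurableT_comp mN measurable_snd).
transitivity (\int[L]_x \int[L]_y h1 (x, y)).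
  rewrite -ge0_integralZr//; last exact: integral_ge0.
  apply: eq_integral => x _; rewrite /h1/= ge0_integralZl//.
  - by rewrite lebesgue_rV_transl.
  - apply: (measurableT_comp mg).
    by apply: (@measurable_rVD _ _ _ id (cst (H x))) => //; exact: measurable_id.
rewrite (fubini_tonelli (m1 := L) (m2 := L) h1)//; last first.
  by move=> p; rewrite mule_ge0.
transitivity (\int[L]_y \int[L]_x h2 (x, y)).
  apply: eq_integral => y _.
  rewrite -(@lebesgue_rV_transl n (- H y)%R (fun x => h1 (x, y))).
  - by apply: eq_integral => x _; rewrite /h1/h2/= HB (addrC y) subrK.
  - exact: (measurableT_comp mh1 (pair2_measurable y)).
  - by move=> x; rewrite mule_ge0.
rewrite -(fubini_tonelli (m1 := L) (m2 := L) h2)//; last first.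
  by move=> p; rewrite mule_ge0.
rewrite -ge0_integralZr//; last exact: integral_ge0.
apply: eq_integral => x _; rewrite /h2/= ge0_integralZr//.
- rewrite muleC; congr (_ * _).
  rewrite -(@lebesgue_rV_transl n (- H x)%R (fun y => f (- y)%R))//.
  by apply: eq_integral => y _; rewrite opprD opprK addrC.
- apply: (measurableT_comp mf).
  by apply: (@measurable_rVD _ _ _ (cst (H x)) (fun y : 'rV[R]_n => - y)%R).
Qed.

(** The image of Lebesgue measure under H is c times Lebesgue measure; applying
    H twice gives c^2 = 1, hence c = 1 as c is nonnegative. *)
Lemma lebesgue_rV_involution (H : 'rV[R]_n -> 'rV[R]_n) (f : 'rV[R]_n -> \bar R) :
  measurable_fun setT H -> involutive H ->
  (forall x y, H (x + y) = H x + H y)%R ->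
  measurable_fun setT f -> (forall y, 0 <= f y) ->
  \int[L]_x f (H x) = \int[L]_x f x.
Proof.
move=> mH HK HD mf f0.
pose g x := (\1_(unit_cube n) x : R)%:E.
have mg : measurable_fun setT g.
  by apply/measurable_EFinP; apply: measurable_indic; exact: measurable_unit_cube.
have g0 x : 0 <= g x by rewrite lee_fin.
have g1 : \int[L]_x g x = 1.
  by rewrite integral_indic//= ?setIT; [exact: lebesgue_unit_cube|exact: measurable_unit_cube].
(* the case H = id of the exchange: invariance under y |-> - y *)
have fN h : measurable_fun setT h -> (forall y, 0 <= h y) ->
    \int[L]_x h (- x)%R = \int[L]_x h x.
  move=> mh h0; have := additive_involution_swap (H := id) (@measurable_id _ _ _)
    (fun x => erefl) (fun x y => erefl) mh h0 mg g0.
  by rewrite g1 mule1 mul1e => ->.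
set c := \int[L]_x g (H x).
have cE h : measurable_fun setT h -> (forall y, 0 <= h y) ->
    \int[L]_x h (H x) = c * \int[L]_x h x.
  move=> mh h0; have := additive_involution_swap mH HK HD mh h0 mg g0.
  by rewrite g1 mule1 fN.
have c0 : 0 <= c by exact: integral_ge0.
have : c * c = 1.
  rewrite -[RHS]g1 /c -cE//; last exact: measurableT_comp.
  by apply: eq_integral => x _; rewrite HK.
rewrite cE//; case: c c0 {cE} => [r||]//; rewrite ?mulyy// lee_fin => r0.
move=> -[] /eqP; rewrite -expr2 sqrf_eq1 => /orP[/eqP ->|/eqP r1].
  by rewrite mul1e.
by move: r0; rewrite r1 ler0N1.
Qed.

End linear_involution.
End lebesgue_rV_theory.

(** * Euclidean geometry of row vectors and of the sphere *)

Section euclidean.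
Context {R : realType}.

Section dot_theory.
Variable n : nat.
Implicit Types u v w x y : 'rV[R]_n.

Lemma dotC u v : dot u v = dot v u.
Proof. by apply: eq_bigr => i _; rewrite mulrC. Qed.

Lemma dotDl u v w : dot (u + v) w = dot u w + dot v w.
Proof. by rewrite /dot -big_split; apply: eq_bigr => i _; rewrite mxE mulrDl. Qed.

Lemma dotZl a u v : dot (a *: u) v = a * dot u v.
Proof. by rewrite /dot mulr_sumr; apply: eq_bigr => i _; rewrite mxE mulrA. Qed.

Lemma dotNl u v : dot (- u) v = - dot u v.
Proof. by rewrite -scaleN1r dotZl mulN1r. Qed.

Lemma dotBl u v w : dot (u - v) w = dot u w - dot v w.
Proof. by rewrite dotDl dotNl. Qed.

Lemma dotDr u v w : dot u (v + w) = dot u v + dot u w.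
Proof. by rewrite dotC dotDl ![dot _ u]dotC. Qed.

Lemma dotZr a u v : dot u (a *: v) = a * dot u v.
Proof. by rewrite dotC dotZl dotC. Qed.

Lemma dotNr u v : dot u (- v) = - dot u v.
Proof. by rewrite dotC dotNl dotC. Qed.

Lemma dotBr u v w : dot u (v - w) = dot u v - dot u w.
Proof. by rewrite dotDr dotNr. Qed.

Lemma dot0l u : dot 0 u = 0.
Proof. by rewrite -(scale0r (0 : 'rV[R]_n)) dotZl mul0r. Qed.

Lemma dot0r u : dot u 0 = 0.
Proof. by rewrite dotC dot0l. Qed.

Lemma dot_ge0 u : 0 <= dot u u.
Proof. by apply: sumr_ge0 => i _; rewrite -expr2 sqr_ge0. Qed.

Lemma dot_eq0 u : (dot u u == 0) = (u == 0).
Proof.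
apply/idP/idP => [|/eqP ->]; last by rewrite dot0l.
rewrite psumr_eq0 => [|i _]; last by rewrite -expr2 sqr_ge0.
move=> /allP h; apply/eqP/rowP => i; rewrite mxE.
by have := h i (mem_index_enum i); rewrite /= mulf_eq0 orbb => /eqP.
Qed.

Lemma dot_gt0 u : (0 < dot u u) = (u != 0).
Proof. by rewrite lt_neqAle dot_ge0 andbT eq_sym dot_eq0. Qed.

Lemma dot_suml (I : Type) (r : seq I) (P : pred I) (F : I -> 'rV[R]_n) v :
  dot (\sum_(i <- r | P i) F i) v = \sum_(i <- r | P i) dot (F i) v.
Proof.
apply: (big_ind2 (fun a b => dot a v = b)) => //; first by rewrite dot0l.
by move=> ? ? ? ? <- <-; rewrite dotDl.
Qed.

Lemma dot_delta u i : dot u (delta_mx ord0 i) = u ord0 i.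
Proof.
rewrite /dot (bigD1 i)//= big1 => [|j /negPf ji].
  by rewrite mxE !eqxx mulr1 addr0.
by rewrite mxE ji andbF mulr0.
Qed.

Lemma CauchySchwarz_dot u v : dot u v ^+ 2 <= dot u u * dot v v.
Proof.
have [->|v0] := eqVneq v 0; first by rewrite !dot0r expr0n mulr0.
have dv : 0 < dot v v by rewrite dot_gt0.
have := dot_ge0 (dot v v *: u - dot u v *: v).
rewrite !(dotBl, dotBr, dotZl, dotZr) (dotC v u).
have -> : dot v v * (dot v v * dot u u - dot u v * dot u v) -
  dot u v * (dot v v * dot u v - dot u v * dot v v) =
  dot v v * (dot u u * dot v v - dot u v ^+ 2) by ring.
by rewrite pmulr_rge0// subr_ge0.
Qed.

Lemma sqr_enorm u : enorm u ^+ 2 = dot u u.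
Proof. by rewrite sqr_sqrtr// dot_ge0. Qed.

Lemma enorm_ge0 u : 0 <= enorm u.
Proof. exact: sqrtr_ge0. Qed.

Lemma enorm_gt0 u : (0 < enorm u) = (u != 0).
Proof. by rewrite sqrtr_gt0 dot_gt0. Qed.

Lemma enormZ a u : enorm (a *: u) = `|a| * enorm u.
Proof. by rewrite /enorm dotZl dotZr mulrA -expr2 sqrtrM ?sqr_ge0// sqrtr_sqr. Qed.

Lemma dot_le_enorm u v : dot u v <= enorm u * enorm v.
Proof.
apply: (le_trans (ler_norm _)).
rewrite -(ler_pXn2r (isT : (0 < 2)%N)) ?nnegrE ?mulr_ge0 ?enorm_ge0//.
by rewrite exprMn !sqr_enorm real_normK ?num_real// CauchySchwarz_dot.
Qed.

(** The reflection in the hyperplane orthogonal to [w]; since division by 0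
    gives 0, it is the identity when [w] is 0, so that [refl (x - y)] exchanges
    two vectors x and y of the same norm even when they are equal. *)
Definition refl w x := x - (2 * (dot x w / dot w w)) *: w.

Lemma reflD w x y : refl w (x + y) = refl w x + refl w y.
Proof. by rewrite /refl dotDl (mulrDl _ _ (dot w w)^-1) (mulrDr 2) scalerDl opprD addrACA. Qed.

Lemma reflZ w a x : refl w (a *: x) = a *: refl w x.
Proof. by rewrite /refl dotZl scalerBr scalerA; congr (_ - _ *: _); ring. Qed.

Lemma dot_refl w x y : dot (refl w x) (refl w y) = dot x y.
Proof.
have [->|w0] := eqVneq w 0; first by rewrite /refl !scaler0 !subr0.
have dw : dot w w != 0 by rewrite dot_eq0.
by rewrite /refl !(dotBl, dotBr, dotZl, dotZr) (dotC w y); field.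
Qed.

Lemma reflK w : involutive (refl w).
Proof.
move=> x; have [->|w0] := eqVneq w 0; first by rewrite /refl !scaler0 !subr0.
have dw : dot w w != 0 by rewrite dot_eq0.
rewrite {1}/refl [dot _ w]dotBl dotZl {1}/refl -addrA -opprD -scalerDl.
set c := (X in x - X *: w); have -> : c = 0 by rewrite /c; field.
by rewrite scale0r subr0.
Qed.

Lemma refl_id w x : dot x w = 0 -> refl w x = x.
Proof. by rewrite /refl => ->; rewrite mul0r mulr0 scale0r subr0. Qed.

(** Reflections act transitively on each sphere, which makes them a substitute
    for the whole orthogonal group. *)
Lemma refl_swap x y : dot x x = dot y y -> refl (x - y) x = y.
Proof.
move=> xy; have [->|w0] := eqVneq x y; first by rewrite /refl subrr scaler0 subr0.
have dw : dot (x - y) (x - y) != 0 by rewrite dot_eq0 subr_eq0.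
rewrite /refl (_ : 2 * _ = 1) ?scale1r ?subKr//.
move: dw; rewrite !(dotBl, dotBr) -xy (dotC y x) => dw.
by apply: (mulIf dw); rewrite mul1r mulrA divfK//; ring.
Qed.

Lemma dot_reflC w x y : dot (refl w x) y = dot x (refl w y).
Proof. by rewrite -[in LHS](reflK w y) dot_refl. Qed.

Lemma enorm_refl w x : enorm (refl w x) = enorm x.
Proof. by rewrite /enorm dot_refl. Qed.

End dot_theory.

Section sphere_theory.
Variable m : nat.
Implicit Types x y : sphere R m.

Lemma sphere_dot x : dot x x = 1.
Proof. by rewrite -sqr_enorm (eqP (sphere_valP x)) expr1n. Qed.

Lemma sphere_of_dot (u : 'rV[R]_m.+1) : dot u u = 1 -> enorm u == 1.
Proof. by rewrite /enorm => ->; rewrite sqrtr1. Qed.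

Lemma sphere_dot_norm x y : `|dot x y| <= 1.
Proof.
rewrite -(ler_pXn2r (isT : (0 < 2)%N)) ?nnegrE// expr1n real_normK ?num_real//.
by rewrite (le_trans (CauchySchwarz_dot _ _))// !sphere_dot mulr1.
Qed.

Lemma sphere_dot_itv x y : -1 <= dot x y <= 1.
Proof. by rewrite -ler_norml sphere_dot_norm. Qed.

Lemma sphere_refl_subproof (w : 'rV[R]_m.+1) x : enorm (refl w x) == 1.
Proof. by rewrite enorm_refl sphere_valP. Qed.

Definition sphere_refl (w : 'rV[R]_m.+1) x : sphere R m :=
  Sphere (sphere_refl_subproof w x).

End sphere_theory.

Section measurability.

Lemma measurable_dotl n d (T : measurableType d) (f : T -> 'rV[R]_n) (u : 'rV[R]_n) :
  measurable_fun setT f -> measurable_fun setT (fun x => dot (f x) u).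
Proof.
move=> /measurable_fun_rVP mf; apply: measurable_sum => i.
exact: measurable_funM.
Qed.

Lemma measurable_sphere_val m : measurable_fun setT (@sphere_val R m).
Proof. by apply/measurable_fun_sphereP; exact: measurable_id. Qed.

Lemma measurable_sphere_dot m (u : 'rV[R]_m.+1) :
  measurable_fun setT (fun x : sphere R m => dot x u).
Proof. exact: (measurable_dotl u (@measurable_sphere_val m)). Qed.

Lemma measurable_refl n (w : 'rV[R]_n) : measurable_fun setT (refl w).
Proof.
apply/measurable_fun_rVP => i; rewrite /refl.
under eq_fun do rewrite !mxE.
apply: measurable_funB; first exact: (measurable_rV_coord i).
apply: measurable_funM; last exact: measurable_cst.
apply: measurable_funM => //; apply: measurable_funM => //.
exact: (@measurable_dotl n _ _ id w).
Qed.

Lemma measurable_sphere_refl m (w : 'rV[R]_m.+1) :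
  measurable_fun setT (@sphere_refl m w).
Proof.
apply/measurable_fun_sphereP.
exact: (measurableT_comp (measurable_refl w) (@measurable_sphere_val m)).
Qed.

Lemma measurable_enorm n : measurable_fun setT (@enorm R n).
Proof.
apply: (@measurableT_comp _ _ _ _ _ _ (@Num.sqrt R)).
  by apply: continuous_measurable_fun; exact: sqrt_continuous.
apply: measurable_sum => i; apply: measurable_funM; exact: (measurable_rV_coord i).
Qed.

(** The function is a real power of the norm also at 0, where both vanish. *)
Lemma measurable_enormV n : measurable_fun setT (fun u : 'rV[R]_n => (enorm u)^-1).
Proof.
rewrite (_ : (fun _ => _) = (@powR R)^~ (- 1) \o @enorm R n).
  by apply: measurableT_comp; [exact: measurable_powR|exact: measurable_enorm].
by apply/funext => u /=; rewrite powR_inv1// enorm_ge0.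
Qed.

End measurability.
End euclidean.

(** * Volume density of the gnomonic charts *)

Section jacobian_gnomonic.
Context {R : realType}.

Lemma dot_cons_rV n (s t : R) (u v : 'rV[R]_n) :
  dot (cons_rV (s, u)) (cons_rV (t, v)) = s * t + dot u v.
Proof.
rewrite /dot (@big_split_ord _ _ _ 1 n) big_ord1 !cons_rVl/=.
by congr (_ + _); apply: eq_bigr => i _; rewrite !cons_rVr.
Qed.

Lemma dot_lift_gnomonic m (b : bool) (z : 'rV[R]_m) :
  dot (cons_rV ((-1) ^+ b, z)) (cons_rV ((-1) ^+ b, z)) = 1 + dot z z.
Proof. by rewrite dot_cons_rV -expr2 sqrr_sign. Qed.

Lemma onedot_gt0 m (z : 'rV[R]_m) : 0 < 1 + dot z z.
Proof. by rewrite ltr_pwDl// dot_ge0. Qed.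

(** The block matrix with rows (1, a z^T) and (z, 1) has two factorizations
    into block triangular matrices; their determinants are the two sides. *)
Lemma det_rank1_update m (a : R) (z : 'rV[R]_m) :
  \det (1%:M - a *: (z^T *m z)) = 1 - a * dot z z.
Proof.
have E : (z *m z^T) = (dot z z)%:M.
  by rewrite [LHS]mx11_scalar; congr (_%:M); rewrite mxE; apply: eq_bigr => i _; rewrite !mxE.
have : \det (block_mx (1%:M : 'M[R]_m) 0 z 1%:M *m
             block_mx (1%:M : 'M[R]_m) (a *: z^T) 0 (1%:M - a *: (z *m z^T))) =
       \det (block_mx (1%:M : 'M[R]_m) (a *: z^T) 0 1%:M *m
             block_mx (1%:M - a *: (z^T *m z)) 0 z 1%:M).
  congr (\det _); rewrite !mulmx_block !(mul1mx, mulmx1, mul0mx, mulmx0, addr0, add0r).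
  by rewrite -scalemxAl subrK -scalemxAr addrC subrK.
rewrite !det_mulmx !det_ublock !det_lblock !det1 !(mul1r, mulr1) => <-.
by rewrite E det_mx11 !mxE mulr1n.
Qed.

(** Restricting to a line reduces an entry of a directional derivative to the
    derivative of a real function of one real variable. *)
Lemma derive_row (V : normedModType R) m (f : V -> 'rV[R]_m) (z v : V) j (l : R) :
  differentiable f z ->
  is_derive (0 : R) 1 (fun h => f (h *: v + z) ord0 j) l ->
  ('D_v f z) ord0 j = l.
Proof.
move=> df dl; have dv : derivable f z v by exact: diff_derivable.
have dv' : h^-1 *: (f (h *: v + z) - f z) @[h --> 0^'] --> 'D_v f z by exact: dv.
have := cvg_comp _ _ dv' (@coord_continuous _ _ _ ord0 j _) => c1.
have dd : derivable (fun h : R => f (h *: v + z) ord0 j) 0 1 by exact: ex_derive.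
have c2 : h^-1 *: (f ((h *: (1 : R) + 0 : R) *: v + z) ord0 j - f ((0 : R) *: v + z) ord0 j)
    @[h --> (0:R)^'] --> l by rewrite -(derive_val (is_derive := dl)); exact: dd.
apply: (cvg_unique _ c1); first exact: norm_hausdorff.
apply: cvg_trans c2; apply: near_eq_cvg; near=> h.
by rewrite /= !mxE scale0r add0r addr0 [h *: 1]mulr1.
Unshelve. all: by end_near. Qed.

Variable m : nat.
Implicit Type z : 'rV[R]_m.

(** The matrix of the linear part z |-> (0, z) of the chart. *)
Definition insert_mx : 'M[R]_(m, m.+1) := \matrix_i cons_rV (0, delta_mx ord0 i).

Lemma gnomonicE b z : gnomonic b z = (Num.sqrt (1 + dot z z))^-1 *: cons_rV ((-1) ^+ b, z).
Proof. by rewrite /gnomonic /enorm dot_lift_gnomonic. Qed.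

(** With q = 1 + |z|^2 and w = ((-1)^b, z), the chart is q^(-1/2) w; the two
    terms come from differentiating w and q^(-1/2). *)
Lemma jacobian_gnomonic (b : bool) z (q := 1 + dot z z) (w := cons_rV ((-1) ^+ b, z)) :
  jacobian (gnomonic b) z =
  (Num.sqrt q)^-1 *: (insert_mx - q^-1 *: (z^T *m w)).
Proof.
have q0 : 0 < q by exact: onedot_gt0.
apply/matrixP => i j.
have -> : jacobian (gnomonic b) z i j = ('D_(delta_mx ord0 i) (gnomonic b) z) ord0 j.
  have D := differentiable_gnomonic b z.
  by rewrite deriveEjacobian// -rowE [RHS]mxE.
apply: derive_row; first exact: differentiable_gnomonic.
pose e : 'rV[R]_m := delta_mx ord0 i.
(* q at the point z + h e *)
pose p (h : R) := 1 + dot z z + 2 * z ord0 i * h + h ^+ 2.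
have pE h : 1 + dot (h *: e + z) (h *: e + z) = p h.
  rewrite !(dotDl, dotDr, dotZl, dotZr) (dotC e z) !dot_delta /e mxE !eqxx /p/=; ring.
pose c0 := w ord0 j; pose c1 := (cons_rV (0, e)) ord0 j.
have E : (fun h : R => gnomonic b (h *: e + z) ord0 j) =
   (fun h => (Num.sqrt (p h))^-1 * (c0 + h * c1)).
  apply/funext => h; rewrite gnomonicE pE mxE; congr (_ * _).
  rewrite (_ : cons_rV _ = w + h *: cons_rV (0, e)).
    by rewrite [LHS]mxE [X in _ + X]mxE.
  by rewrite cons_rVZ cons_rVD mulr0 addr0 addrC.
have p0 : p 0 = q by rewrite /p mulr0 expr0n/= !addr0.
have sq : Num.sqrt q != 0 by rewrite gt_eqF// sqrtr_gt0.
rewrite E.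
have d1 : is_derive (0 : R) 1 p (2 * z ord0 i).
  rewrite /p; apply: is_derive_eq; rewrite !(scaler0, scale0r, add0r, addr0, expr1, mulr0)//=.
  by rewrite mul1r [LHS]mulr1.
have d2 : is_derive (0 : R) 1 (Num.sqrt \o p) ((2 * Num.sqrt q)^-1 * (2 * z ord0 i)).
  apply: is_derive1_comp; first by rewrite p0; exact: is_derive1_sqrt.
have d3 : is_derive (0 : R) 1 (fun h => (Num.sqrt (p h))^-1)
   (- (Num.sqrt q) ^- 2 *: ((2 * Num.sqrt q)^-1 * (2 * z ord0 i))).
  have sq' : (Num.sqrt \o p) 0 != 0 by rewrite /= p0.
  by have := is_deriveV sq' d2; rewrite /= p0.
have d4 : is_derive (0 : R) 1 (fun h => c0 + h * c1) c1.
  apply: is_derive_eq; rewrite !(scaler0, scale0r, add0r, addr0, expr1, mulr0)//=.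
  by rewrite mul1r [LHS]mulr1.
have := is_deriveM d3 d4; rewrite /= p0 mul0r addr0.
set l' := (X in is_derive _ _ _ X -> _) => dl.
apply: (is_derive_eq dl); rewrite /l' [RHS]mxE [X in _ = _ * X]mxE [X in _ = _ * (X + _)]mxE -/e -/c1.
rewrite [X in _ = _ * (_ + X)]mxE [X in _ = _ * (_ - X)]mxE.
rewrite [X in _ = _ * (_ - _ * X)]mxE big_ord1 [z^T _ _]mxE -/c0.
have s2 : Num.sqrt q ^+ 2 = q by rewrite sqr_sqrtr// ltW.
rewrite /GRing.scale/=; set s := Num.sqrt q in s2 sq *.
by rewrite -s2; field.
Qed.

(** The Gram matrix of the Jacobian is q^(-1) (1 - q^(-1) z^T z), a rank one
    update of a scalar matrix, with determinant q^(- m - 1). *)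
Lemma volume_density_gnomonic (b : bool) z :
  volume_density (gnomonic b) z = (Num.sqrt (1 + dot z z))^-1 ^+ m.+1.
Proof.
set q := 1 + dot z z; set w := cons_rV ((-1) ^+ b, z).
have q0 : 0 < q by exact: onedot_gt0.
have qn0 : q != 0 by rewrite gt_eqF.
have s2 : Num.sqrt q ^+ 2 = q by rewrite sqr_sqrtr// ltW.
have EE : insert_mx *m insert_mx^T = 1%:M.
  apply/matrixP => i j; rewrite [LHS]mxE [RHS]mxE.
  have -> : (i == j)%:R = dot (cons_rV (0, delta_mx ord0 i)) (cons_rV (0, delta_mx ord0 j)) :> R.
    by rewrite dot_cons_rV mul0r add0r dot_delta mxE eqxx eq_sym.
  by apply: eq_bigr => k _; rewrite [insert_mx^T _ _]mxE ![insert_mx _ _]mxE.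
have wE : w *m insert_mx^T = z.
  apply/rowP => j; rewrite [LHS]mxE.
  transitivity (dot w (cons_rV (0, delta_mx ord0 j))).
    by apply: eq_bigr => k _; rewrite [insert_mx^T _ _]mxE [insert_mx _ _]mxE.
  by rewrite dot_cons_rV mulr0 add0r dot_delta.
have Ew : insert_mx *m w^T = z^T by rewrite -[LHS]trmxK trmx_mul trmxK wE.
have ww : w *m w^T = q%:M.
  rewrite [LHS]mx11_scalar; congr (_%:M); rewrite /q -(dot_lift_gnomonic b) mxE.
  by apply: eq_bigr => k _; rewrite [w^T _ _]mxE.
rewrite /volume_density jacobian_gnomonic -/q -/w.
set s := Num.sqrt q in s2 *.
have -> : s^-1 *: (insert_mx - q^-1 *: (z^T *m w)) *m
    (s^-1 *: (insert_mx - q^-1 *: (z^T *m w)))^T =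
    q^-1 *: (1%:M - q^-1 *: (z^T *m z)).
  have trZ k l (a : R) (A : 'M[R]_(k, l)) : (a *: A)^T = a *: A^T.
    by apply/matrixP => i j; rewrite !mxE.
  rewrite trZ -scalemxAl -scalemxAr scalerA -expr2 exprVn s2; congr (_ *: _).
  rewrite [(_ - _)^T]linearB/= trZ trmx_mul trmxK mulmxBl !mulmxBr EE.
  rewrite -!scalemxAl -!scalemxAr -mulmxA wE mulmxA Ew.
  rewrite (_ : z^T *m w *m (w^T *m z) = q *: (z^T *m z)); last first.
    by rewrite mulmxA -(mulmxA z^T) ww mul_mx_scalar scalemxAl.
  by rewrite [q^-1 *: (q *: _)]scalerA mulVf// scale1r subrr subr0.
rewrite detZ det_rank1_update.
have -> : 1 - q^-1 * dot z z = q^-1.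
  by rewrite (_ : dot z z = q - 1); [field|rewrite /q addrC addKr].
by rewrite -exprSr -s2 -exprVn -exprM mulnC exprM sqrtr_sqr ger0_norm// exprn_ge0// invr_ge0 sqrtr_ge0.
Qed.

End jacobian_gnomonic.

(** * Reflection invariance of the volume *)

Section cone.
Context {R : realType}.
Notation leb := (@lebesgue_measure R).

(** The weight |y|^(- m) cancels the factor t^m of polar coordinates, so that
    the radial integral is the length of an interval. *)
Definition cone_density m (B : set 'rV[R]_m.+1) (y : 'rV[R]_m.+1) : R :=
  (enorm y)^-1 ^+ m * (\1_(`]0%R, 1%R]%classic : set R) (enorm y) * \1_B ((enorm y)^-1 *: y)).

Lemma cone_density_ge0 m (B : set 'rV[R]_m.+1) y : 0 <= cone_density B y.
Proof. by rewrite mulr_ge0// ?mulr_ge0// exprn_ge0// invr_ge0 enorm_ge0. Qed.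

Lemma measurable_cone_density m (B : set 'rV[R]_m.+1) : measurable B ->
  measurable_fun setT (cone_density B).
Proof.
move=> mB; apply: measurable_funM.
  by apply: measurable_funX; exact: measurable_enormV.
apply: measurable_funM.
  apply: (@measurableT_comp _ _ _ _ _ _ (\1_(`]0%R, 1%R]%classic : set R) : R -> R)).
    exact: measurable_indic.
  exact: measurable_enorm.
apply: (@measurableT_comp _ _ _ _ _ _ (\1_B : _ -> R)); first exact: measurable_indic.
by apply: (measurable_rVZ (@measurable_enormV R m.+1)); exact: measurable_id.
Qed.

(** Along the line of direction (1, u), the change of variable by |t| turns the
    density into the indicators of the two intervals of length 1 / |(1, u)| on
    either side of 0; the positive side belongs to the chart [false], the
    negative one to the chart [true].  Both sides vanish at t = 0. *)
Lemma cone_density_ray m (B : set 'rV[R]_m.+1) (t : R) (u : 'rV[R]_m) :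
  `|t| ^+ m * cone_density B (cons_rV (t, `|t| *: u)) =
  \sum_(b : bool) (enorm (cons_rV ((-1) ^+ b, u)))^-1 ^+ m * \1_B (gnomonic b u) *
    \1_((if b then `[- (enorm (cons_rV ((-1) ^+ b, u)))^-1, 0[%classic
             else `]0, (enorm (cons_rV ((-1) ^+ b, u)))^-1]%classic) : set R) t.
Proof.
have nE (b : bool) : enorm (cons_rV ((-1) ^+ b, u)) = Num.sqrt (1 + dot u u).
  by rewrite /enorm dot_lift_gnomonic.
have N0 : 0 < Num.sqrt (1 + dot u u) by rewrite sqrtr_gt0 onedot_gt0.
rewrite big_bool !nE/=; set N := Num.sqrt _ in nE N0 *.
have [->|t0] := eqVneq t 0.
  rewrite normr0 scale0r /cone_density.
  have -> : cons_rV (0, 0) = 0 :> 'rV[R]_m.+1.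
    by apply: cons_rVP => j; rewrite !(cons_rVl, cons_rVr) !mxE.
  rewrite /enorm dot0l sqrtr0 ![\1_[set` _] _]indicE.
  by rewrite !memNset ?(mulr0, mul0r, addr0)//= in_itv/= ltxx ?andbF.
pose b := t < 0.
have tE : t = `|t| * (-1) ^+ b.
  rewrite /b; case: ltrP => h; first by rewrite ltr0_norm// expr1 mulrN1 opprK.
  by rewrite ger0_norm// mulr1.
have vE : cons_rV (t, `|t| *: u) = `|t| *: cons_rV ((-1) ^+ b, u).
  by rewrite cons_rVZ -tE.
have t0' : 0 < `|t| by rewrite normr_gt0.
rewrite /cone_density vE enormZ normr_id nE scalerA invfM mulrAC mulVf ?gt_eqF// mul1r.
have -> : N^-1 *: cons_rV ((-1) ^+ b, u) = gnomonic b u by rewrite gnomonicE.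
rewrite exprMn !mulrA -exprMn divff ?gt_eqF// expr1n mul1r.
have [h|h] : t < 0 \/ 0 < t by case: ltgtP t0 => //; [left|right].
  have bE : b = true by [].
  rewrite bE [X in _ + X](_ : _ = 0) ?addr0; last first.
    by rewrite [X in _ * X]indicE memNset ?mulr0//= in_itv/= ltNge (ltW h).
  rewrite mulrAC; congr (_ * _); rewrite !indicE; congr (_%:R).
  rewrite ltr0_norm//; congr nat_of_bool; apply/idP/idP; rewrite !inE/= !in_itv/=.
    by rewrite -ler_pdivlMr// div1r => /andP[_ h']; rewrite h andbT lerNl.
  by rewrite lerNl => /andP[h' _]; rewrite mulr_gt0 ?oppr_gt0// -ler_pdivlMr// div1r.
have bE : b = false by rewrite /b ltNge (ltW h).
rewrite bE [X in X + _](_ : _ = 0) ?add0r; last first.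
  by rewrite [X in _ * X]indicE memNset ?mulr0//= in_itv/= [t < 0]ltNge (ltW h) andbF.
rewrite mulrAC; congr (_ * _); rewrite !indicE; congr (_%:R).
rewrite gtr0_norm//; congr nat_of_bool; apply/idP/idP; rewrite !inE/= !in_itv/=.
  by rewrite -ler_pdivlMr// div1r => /andP[_ h']; rewrite h.
by move=> /andP[_ h']; rewrite mulr_gt0// -ler_pdivlMr// div1r.
Qed.

Local Open Scope ereal_scope.

(** Polar coordinates by Tonelli alone: split off the first coordinate t, scale
    the others by |t|, and exchange the integrals.  What remains for each chart
    is its volume density |(1, u)|^(- m - 1), one factor 1 / |(1, u)| being the
    length found in [cone_density_ray]. *)
Lemma sphere_vol_cone m (B : set 'rV[R]_m.+1) : measurable B ->
  sphere_vol (@sphere_val R m @^-1` B) =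
  \int[lebesgue_rV R m.+1]_y (cone_density B y)%:E.
Proof.
move=> mB.
have mF : measurable_fun setT (fun y => (cone_density B y)%:E).
  by apply/measurable_EFinP; exact: measurable_cone_density.
have F0 y : 0 <= (cone_density B y)%:E by rewrite lee_fin cone_density_ge0.
have mFc : measurable_fun setT ((fun y => (cone_density B y)%:E) \o @cons_rV R m).
  exact: (measurableT_comp mF (@measurable_cons_rV R m)).
rewrite integral_lebesgue_rVS//.
pose G (p : measurableTypeR R * 'rV[R]_m) :=
  (`|p.1| ^+ m * cone_density B (cons_rV (p.1, (`|p.1| *: p.2)%R)))%:E.
have mn : measurable_fun setT (fun p : measurableTypeR R * 'rV[R]_m => `|p.1|%R : R).
  exact: (measurableT_comp (@normr_measurable R setT) measurable_fst).
have mG : measurable_fun setT G.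
  apply/measurable_EFinP; apply: measurable_funM; first exact: measurable_funX.
  apply: (measurableT_comp (measurable_cone_density mB)).
  apply: (measurableT_comp (@measurable_cons_rV R m)).
  apply: measurable_fun_pair; first exact: measurable_fst.
  by apply: (measurable_rVZ mn); exact: measurable_snd.
have G0 p : 0 <= G p by rewrite lee_fin mulr_ge0 ?exprn_ge0 ?cone_density_ge0.
(* the scaling by |t| is invalid at t = 0 only, a null set *)
transitivity (\int[leb]_t \int[lebesgue_rV R m]_u G (t, u)); last first.
  have mI1 : measurable_fun (setT `\ (0%R : R))
      (fun t => \int[lebesgue_rV R m]_u G (t, u)).
    by apply: measurable_funTS; exact: measurable_fun_fubini_tonelli_F.
  have mI2 : measurable_fun (setT `\ (0%R : R))
      (fun t => \int[lebesgue_rV R m]_u (cone_density B (cons_rV (t, u)))%:E).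
    apply: measurable_funTS.
    apply: (@measurable_fun_fubini_tonelli_F _ _ _ _ R (lebesgue_rV R m)
      ((fun y => (cone_density B y)%:E) \o @cons_rV R m)) => //.
    by move=> p; exact: F0.
  have mD : measurable ([set: R] `\ 0%R) by exact: measurableD.
  rewrite -(integral_setD1 mD mI1) -(integral_setD1 mD mI2).
  apply: eq_integral => t; rewrite inE/= => -[_ /eqP t0].
  have t0' : (0 < `|t|)%R by rewrite normr_gt0.
  rewrite -[RHS](@lebesgue_rV_affine R m `|t| 0%R
     (fun u => (cone_density B (cons_rV (t, u)))%:E))//; last first.
    exact: (measurableT_comp mFc (pair1_measurable t)).
  have mt : measurable_fun setT
      (fun u : 'rV[R]_m => (cone_density B (cons_rV (t, `|t| *: u + 0)%R))%:E).
    apply: (measurableT_comp mFc); apply: measurable_fun_pair => //.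
    apply: (@measurable_rVD _ _ _ _ (fun y : 'rV[R]_m => `|t| *: y)%R (cst 0%R)) => //.
    exact: (@measurable_rVZ _ _ _ _ (cst `|t|%R) id).
  have tm : 0 <= (`|t| ^+ m)%:E by rewrite lee_fin exprn_ge0.
  transitivity (\int[lebesgue_rV R m]_u ((`|t| ^+ m)%:E *
      (cone_density B (cons_rV (t, `|t| *: u + 0)%R))%:E)).
    by apply: eq_integral => u _; rewrite addr0 -EFinM.
  exact: (@ge0_integralZl _ _ R (lebesgue_rV R m) setT _ _ mt).
rewrite (fubini_tonelli (m1 := leb) (m2 := lebesgue_rV R m) G)//.
transitivity (\int[lebesgue_rV R m]_u \sum_(b : bool)
   ((\1_(gnomonic_chart b @^-1` (@sphere_val R m @^-1` B)) u * volume_density (gnomonic b) u)%:E)).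
  rewrite ge0_integral_sum//; last 2 first.
  - move=> b; apply/measurable_EFinP; apply: measurable_funM; last first.
      apply: measurable_volume_density; first exact: measurable_gnomonic.
      exact: differentiable_gnomonic.
    apply: measurable_indic; rewrite -[X in measurable X]setTI.
    by apply: (measurable_gnomonic b).
  - by move=> b u _; rewrite lee_fin mulr_ge0// sqrtr_ge0.
  rewrite /sphere_vol; apply: eq_bigr => b _; rewrite [LHS]integral_mkcond.
  apply: eq_integral => u _; rewrite patchE indicE.
  by case: ifP => _; rewrite ?mul1r ?mul0r.
apply: eq_integral => u _.
under [RHS]eq_integral do rewrite /G/= cone_density_ray -sumEFin.
rewrite ge0_integral_sum//; last 2 first.
- move=> b; apply/measurable_EFinP; apply: measurable_funM => //.
  by apply: measurable_indic; case: b.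
- by move=> b t _; rewrite lee_fin !mulr_ge0// exprn_ge0// invr_ge0 enorm_ge0.
apply: eq_bigr => b _.
rewrite volume_density_gnomonic.
have nE : enorm (cons_rV ((-1) ^+ b, u))%R = Num.sqrt (1 + dot u u)%R.
  by rewrite /enorm dot_lift_gnomonic.
have N0 : (0 < Num.sqrt (1 + dot u u))%R by rewrite sqrtr_gt0 onedot_gt0.
rewrite nE; set N := Num.sqrt _ in N0 *.
under eq_integral do rewrite EFinM.
rewrite ge0_integralZl//; last 2 first.
- by apply/measurable_EFinP; apply: measurable_indic; case: b {nE}.
- by rewrite lee_fin !mulr_ge0// exprn_ge0// invr_ge0 ltW.
rewrite integral_indic//; last by case: b {nE}.
rewrite setIT [X in _ * X](_ : _ = (N^-1)%:E); last first.
  have L1 : leb `[(- N^-1)%R, 0%R[%classic = (N^-1)%:E.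
    by rewrite lebesgue_measure_itv/= lte_fin oppr_lt0 invr_gt0 N0 -EFinD sub0r opprK.
  have L2 : leb `]0%R, (N^-1)%R]%classic = (N^-1)%:E.
    by rewrite lebesgue_measure_itv/= lte_fin invr_gt0 N0 -EFinD subr0.
  by case: b {nE}; [exact: L1|exact: L2].
by rewrite -EFinM; congr EFin; rewrite exprSr mulrA; congr (_ * _)%R; rewrite mulrC.
Qed.

End cone.

Section reflection_invariance.
Context {R : realType} {m : nat}.
Local Open Scope ereal_scope.

(** The norm is preserved by the reflection, which commutes with scaling, so
    the cone density of the preimage is the cone density composed with it. *)
Lemma sphere_vol_refl (w : 'rV[R]_m.+1) (A : set (sphere R m)) : measurable A ->
  sphere_vol (sphere_refl w @^-1` A) = sphere_vol A.
Proof.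
move=> [B mB <-]; rewrite !setTI.
have mB' : measurable (refl w @^-1` B).
  by rewrite -[X in measurable X]setTI; exact: measurable_refl.
rewrite [LHS](sphere_vol_cone mB') sphere_vol_cone//.
rewrite -(@lebesgue_rV_involution _ _ (refl w) (fun y => (cone_density B y)%:E))//.
- apply: eq_integral => y _; congr EFin; rewrite /cone_density enorm_refl; congr (_ * (_ * _))%R.
  by rewrite -reflZ.
- exact: measurable_refl.
- exact: reflK.
- exact: reflD.
- by apply/measurable_EFinP; exact: measurable_cone_density.
- by move=> y; rewrite lee_fin cone_density_ge0.
Qed.

Lemma integral_sphere_refl (w : 'rV[R]_m.+1) (f : sphere R m -> \bar R) :
  measurable_fun setT f -> (forall x, 0 <= f x) ->
  \int[sphere_vol]_x f (sphere_refl w x) = \int[sphere_vol]_x f x.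
Proof.
move=> mf f0; have mr := @measurable_sphere_refl R m w.
rewrite -(ge0_integral_image_measure _ mr)//.
apply: eq_measure_integral => A mA _; exact: sphere_vol_refl.
Qed.

End reflection_invariance.

(** * Geodesic distance *)

Section geodesic.
Context {R : realType}.

Section curves.
Variable n : nat.
Implicit Types (f g : R -> 'rV[R]_n).

Lemma is_derive_dot f g (t : R) : derivable f t 1 -> derivable g t 1 ->
  is_derive t 1 (fun s => dot (f s) (g s))
    (dot (derive1 f t) (g t) + dot (f t) (derive1 g t)).
Proof.
move=> df dg.
have dc h i : derivable h t 1 ->
    is_derive t 1 (fun s : R => (h s : 'rV[R]_n) ord0 i) (derive1 h t ord0 i).
  move=> dh; have dhi := (derivable_mxP h t 1).1 dh ord0 i.
  by rewrite derive1E derive_mx// mxE; exact: derivableP.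
rewrite (_ : (fun s => _) = \sum_(i < n) (fun s => f s ord0 i * g s ord0 i)); last first.
  by apply/funext => s; rewrite fct_sumE.
have := is_derive_sum (fun i => is_deriveM (dc f i df) (dc g i dg)).
move=> h; apply: (is_derive_eq h); rewrite /dot -big_split/=; apply: eq_bigr => i _.
by rewrite addrC; congr (_ + _); rewrite /GRing.scale/= mulrC.
Qed.

Lemma is_derive_dot_cst f u (t : R) : derivable f t 1 ->
  is_derive t 1 (fun s => dot (f s) u) (dot (derive1 f t) u).
Proof.
move=> df; have du : derivable (cst u : R -> 'rV[R]_n) t 1 by exact: derivable_cst.
have := is_derive_dot df du; rewrite derive1_cst dot0r addr0; exact.
Qed.

Lemma continuous_dot f g : continuous f -> continuous g ->
  continuous (fun t => dot (f t) (g t)).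
Proof.
move=> cf cg.
have cc h i : continuous h -> continuous (fun t : R => (h t : 'rV[R]_n) ord0 i).
  move=> ch t; apply: (@continuous_comp _ _ _ h (fun M : 'rV[R]_n => M ord0 i)).
    exact: ch.
  exact: coord_continuous.
rewrite (_ : (fun s => _) = \sum_(i < n) (fun s => f s ord0 i * g s ord0 i)); last first.
  by apply/funext => s; rewrite fct_sumE.
apply: (@big_ind _ (fun h : R -> R => continuous h)).
- by move=> t; exact: cst_continuous.
- by move=> h k ch ck t; apply: continuousD; [exact: ch|exact: ck].
- by move=> i _ t; apply: continuousM; exact: cc.
Qed.

Lemma continuous_enorm f : continuous f -> continuous (fun t => enorm (f t)).
Proof.
move=> cf t; apply: (@continuous_comp _ _ _ (fun t => dot (f t) (f t)) Num.sqrt).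
  exact: continuous_dot.
exact: sqrt_continuous.
Qed.

Lemma continuous_integrable01 (f : R -> R) : continuous f ->
  lebesgue_measure.-integrable `[0, 1]%classic (EFin \o f).
Proof.
move=> cf; apply: continuous_compact_integrable; first exact: segment_compact.
exact: continuous_subspaceT.
Qed.

End curves.

Variable m : nat.
Implicit Types (x y : sphere R m) (g : R -> sphere R m).

Lemma curve_length_ge0 g : 0 <= curve_length g.
Proof. by apply: Rintegral_ge0 => t _; exact: enorm_ge0. Qed.

(** The velocity is tangent to the sphere, so only the tangential part of [x]
    matters; its norm is the square root on the right. *)
Lemma speed_bound g x t : (forall s, derivable (fun r => sphere_val (g r)) s 1) ->
  `|dot (derive1 (fun r => sphere_val (g r)) t) x| <=
  enorm (derive1 (fun r => sphere_val (g r)) t) * Num.sqrt (1 - dot (g t) x ^+ 2).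
Proof.
move=> dg; set v := derive1 _ t.
have vg : dot v (g t) = 0.
  have h := is_derive_dot (dg t) (dg t).
  have h0 : is_derive t 1 (fun s => dot (g s) (g s)) 0.
    rewrite (_ : (fun s => _) = cst 1); first exact: is_derive_cst.
    by apply/funext => s; rewrite /= sphere_dot.
  have := derive_val (is_derive := h); rewrite (derive_val (is_derive := h0)) -/v.
  rewrite [dot (g t) v]dotC => /esym/eqP; rewrite -mulr2n mulrn_eq0/= => /eqP//.
have -> : dot v x = dot v (sphere_val x - dot (g t) x *: sphere_val (g t)).
  by rewrite dotBr dotZr vg mulr0 subr0.
have -> : 1 - dot (g t) x ^+ 2 = dot (sphere_val x - dot (g t) x *: sphere_val (g t))
    (sphere_val x - dot (g t) x *: sphere_val (g t)).
  by rewrite !(dotBl, dotBr, dotZl, dotZr) !sphere_dot (dotC x (g t)); ring.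
rewrite ler_norml dot_le_enorm andbT lerNl -dotNr.
by rewrite (le_trans (dot_le_enorm _ _))// /enorm dotNl dotNr opprK.
Qed.

(** The angle acos <g, x> decreases and increases no faster than the length, but
    acos is not differentiable at the ends of its domain.  Multiplying its
    argument by cos dl < 1 keeps it inside, keeps the speed bound, and only
    shifts the initial angle from 0 to dl. *)
Lemma curve_length_ge_regularized g (dl : R) : C1_curve g -> 0 < dl -> dl < pi / 2 ->
  acos (cos dl * dot (g 1) (g 0)) <= curve_length g + dl.
Proof.
move=> [dg cg] dl0 dlpi.
set x := g 0; set k := cos dl.
have k0 : 0 < k by apply: cos_gt0_pihalf; rewrite dlpi andbT (lt_trans _ dl0)// oppr_lt0 divr_gt0 ?pi_gt0.
have k1 : k < 1.
  rewrite -cos0 /k ltr_cos// in_itv/= ?lexx ?pi_ge0// ltW//=.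
  by rewrite ltW// (lt_trans dlpi)// ltr_pdivrMr// ltr_pMr ?pi_gt0// ltr1n.
pose phi (t : R) := dot (g t) x.
pose v := derive1 (fun r => sphere_val (g r)).
have kphi t : -1 < k * phi t < 1.
  rewrite -ltr_norml normrM gtr0_norm//; apply: le_lt_trans k1.
  by rewrite ger_pMr//; exact: sphere_dot_norm.
have q0 t : 0 < 1 - (k * phi t) ^+ 2.
  by rewrite subr_gt0 -real_normK ?num_real// expr_lt1// ltr_norml.
pose psi' t := - (Num.sqrt (1 - (k * phi t) ^+ 2))^-1 * (k * dot (v t) x).
have dpsi (t : R) : is_derive t 1 (acos \o (fun t => k * phi t)) (psi' t).
  have dk : is_derive t 1 (fun t => k * phi t) (k * dot (v t) x).
    have := is_deriveZ k (is_derive_dot_cst (sphere_val x) (dg t)); exact.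
  exact: (@is_derive1_comp _ acos (fun t => k * phi t) t _ _ (is_derive1_acos (kphi t)) dk).
have dphi (t : R) : is_derive t 1 phi (dot (v t) x) by exact: is_derive_dot_cst.
have cphi : continuous phi.
  by move=> t; apply/differentiable_continuous/derivable1_diffP/ex_derive.
have ccst (u : 'rV[R]_m.+1) : continuous (cst u : R -> 'rV[R]_m.+1).
  by move=> t; exact: cst_continuous.
have cpsi' : continuous psi'.
  move=> t; rewrite /continuous_at /psi'; apply: cvgM.
    apply: cvgN; apply: cvgV; first by rewrite gt_eqF// sqrtr_gt0.
    apply: (@continuous_comp _ _ _ (fun t => 1 - (k * phi t) ^+ 2) Num.sqrt); last exact: sqrt_continuous.
    rewrite /continuous_at; apply: cvgB; first exact: cvg_cst.
    by apply: cvgM; apply: cvgM; do ?exact: cvg_cst; exact: cphi.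
  apply: cvgM; first exact: cvg_cst.
  exact: (continuous_dot cg (ccst x)).
have cpsi : continuous (acos \o (fun t => k * phi t)).
  by move=> t; apply/differentiable_continuous/derivable1_diffP/ex_derive.
have FTC : \int[lebesgue_measure]_(t in `[0, 1]) psi' t =
    acos (k * phi 1) - acos (k * phi 0).
  rewrite /Rintegral (@continuous_FTC2 _ psi' (acos \o (fun t => k * phi t)))//.
  - exact: continuous_subspaceT.
  - split; first by move=> t _; exact: ex_derive.
    + exact/cvg_at_right_filter/cpsi.
    + exact/cvg_at_left_filter/cpsi.
  - by move=> t _; rewrite derive1E; exact: derive_val.
have phi0 : acos (k * phi 0) = dl.
  rewrite /phi sphere_dot mulr1 cosK// in_itv/= ltW//=.
  by rewrite ltW// (lt_trans dlpi)// ltr_pdivrMr// ltr_pMr ?pi_gt0// ltr1n.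
rewrite -lerBlDr -[X in _ - X]phi0 -FTC.
apply: le_Rintegral => //.
- exact: continuous_integrable01.
- exact/continuous_integrable01/continuous_enorm.
move=> t _; rewrite (le_trans (ler_norm _))// /psi' normrM normrN normrM (gtr0_norm k0).
rewrite normfV (ger0_norm (sqrtr_ge0 _)) mulrC ler_pdivrMr ?sqrtr_gt0//.
apply: (@le_trans _ _ (`|dot (v t) x|)); first by rewrite ler_piMl// ltW.
apply: (le_trans (speed_bound x t dg)).
rewrite ler_wpM2l ?enorm_ge0// ler_wsqrtr// lerD2l lerN2 exprMn.
by rewrite ler_piMl ?sqr_ge0// exprn_ile1// ltW.
Qed.

(** Apply the cosine to the regularized inequality and let dl tend to 0. *)
Lemma curve_length_ge g : C1_curve g -> acos (dot (g 1) (g 0)) <= curve_length g.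
Proof.
move=> Cg; rewrite leNgt; apply/negP => Llt.
set d := dot _ _ in Llt; set L := curve_length g in Llt.
have dI : -1 <= d <= 1 by exact: sphere_dot_itv.
have L0 : 0 <= L by exact: curve_length_ge0.
have tpi : acos d <= pi by exact: acos_lepi.
suff : cos L <= d.
  rewrite leNgt -[X in X < _](acosK (x := d))// ltr_cos ?Llt// in_itv/=.
    by rewrite L0 ltW// (lt_le_trans Llt).
  by rewrite acos_ge0.
apply: (@ler_cvg_to _ (0 : R)^'+ _ _ (fun h => cos (L + h)) (fun h => cos h * d)).
- rewrite -[X in _ --> cos X]addr0; apply: cvg_at_right_filter.
  apply: (@continuous_comp _ _ _ (fun h => L + h) cos); last exact: continuous_cos.
  by apply: continuousD => //; exact: cst_continuous.
- rewrite -[X in _ --> X]mul1r -cos0; apply: cvg_at_right_filter.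
  by apply: cvgM; [exact: continuous_cos|exact: cvg_cst].
near=> h.
have h0 : 0 < h by near: h; exact: nbhs_right_gt.
have hpi : h < pi / 2 by near: h; apply: nbhs_right_lt; rewrite divr_gt0 ?pi_gt0.
have hL : h < acos d - L by near: h; apply: nbhs_right_lt; rewrite subr_gt0.
have hI : -1 <= cos h * d <= 1.
  by rewrite -ler_norml normrM mulr_ile1 ?ler_norml ?cos_geN1 ?cos_le1.
have := curve_length_ge_regularized Cg h0 hpi; rewrite -/d -/L => le1.
rewrite leNgt -[X in X < _](acosK (x := cos h * d))// ltr_cos ?in_itv/= ?acos_ge0 ?acos_lepi//.
  by rewrite -leNgt.
by rewrite addr_ge0 ?(ltW h0)//= ltW// (lt_le_trans _ tpi)// -ltrBrDl.
Unshelve. all: by end_near. Qed.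

(** When x and y are linearly dependent any unit vector orthogonal to x will do;
    it is obtained from a basis vector whose coordinate in x has absolute value
    less than 1.  Such a vector exists because the squares of the m + 1 > 1
    coordinates add up to 1. *)
Lemma exists_orthonormal x y : (0 < m)%N ->
  exists e : 'rV[R]_m.+1, [/\ dot e e = 1, dot x e = 0 &
    sphere_val y = cos (acos (dot x y)) *: sphere_val x + sin (acos (dot x y)) *: e].
Proof.
move=> m0; have dI := sphere_dot_itv x y.
rewrite acosK// sin_acos//; set d := dot x y in dI *.
have unit_orth (u : 'rV[R]_m.+1) : u != 0 -> dot x u = 0 ->
    dot ((enorm u)^-1 *: u) ((enorm u)^-1 *: u) = 1 /\ dot x ((enorm u)^-1 *: u) = 0.
  move=> u0 xu; rewrite !(dotZl, dotZr) xu mulr0 -sqr_enorm; split => //.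
  by field; rewrite gt_eqF// enorm_gt0.
have nE : dot (sphere_val y - d *: sphere_val x) (sphere_val y - d *: sphere_val x) = 1 - d ^+ 2.
  by rewrite !(dotBl, dotBr, dotZl, dotZr) !sphere_dot (dotC y x) -/d; ring.
have [w0|w0] := eqVneq (sphere_val y - d *: sphere_val x) 0; last first.
  exists ((enorm (sphere_val y - d *: sphere_val x))^-1 *: (sphere_val y - d *: sphere_val x)).
  have [|h1 h2] := unit_orth _ w0.
    by rewrite dotBr dotZr sphere_dot -/d mulr1 subrr.
  split=> //; rewrite -nE -/(enorm _) scalerA divff ?scale1r; last by rewrite gt_eqF// enorm_gt0.
  by rewrite addrC subrK.
have s0 : 1 - d ^+ 2 = 0 by rewrite -nE w0 dot0l.
have [i xi] : exists i : 'I_m.+1, `|x ord0 i| < 1.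
  apply/existsP; apply: contraT; rewrite negb_exists => /forallP h.
  have h1 i : 1 <= (sphere_val x) ord0 i * (sphere_val x) ord0 i.
    have := h i; rewrite -leNgt => hi.
    by rewrite -expr2 -real_normK ?num_real// exprn_ege1.
  have : \sum_(i < m.+1) (1 : R) <= dot x x by apply: ler_sum => i _; exact: h1.
  rewrite sphere_dot sumr_const card_ord -[leRHS]mulr1n ler_nat => mm.
  by move: m0; rewrite lt0n; case: (m) mm.
pose u := delta_mx ord0 i - x ord0 i *: sphere_val x.
have xu : dot x u = 0.
  by rewrite dotBr dotZr sphere_dot dot_delta mulr1 subrr.
have u0 : u != 0.
  rewrite -dot_eq0 /u !(dotBl, dotBr, dotZl, dotZr) sphere_dot.
  rewrite (dotC _ (sphere_val x)) !dot_delta mxE !eqxx/=.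
  rewrite (_ : _ - _ = 1 - x ord0 i ^+ 2); last by ring.
  by rewrite gt_eqF// subr_gt0 -real_normK ?num_real// expr_lt1.
have [h1 h2] := unit_orth u u0 xu.
exists ((enorm u)^-1 *: u); split => //.
by rewrite s0 sqrtr0 scale0r addr0; apply/eqP; rewrite -subr_eq0 w0.
Qed.

Lemma great_circle_norm x (e : 'rV[R]_m.+1) (a : R) : dot e e = 1 -> dot x e = 0 ->
  enorm (cos a *: sphere_val x + sin a *: e) == 1.
Proof.
move=> ee xe; apply/eqP/eqP; apply: sphere_of_dot.
rewrite !(dotDl, dotDr, dotZl, dotZr) sphere_dot ee (dotC e) xe.
by rewrite !mulr0 !mulr1 addr0 add0r -!expr2 cos2Dsin2.
Qed.

Lemma curve_great_circle x y : (0 < m)%N ->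
  exists2 g, [/\ C1_curve g, g 0 = x & g 1 = y] & curve_length g = acos (dot x y).
Proof.
move=> m0; have [e [ee xe yE]] := exists_orthonormal x y m0.
set th := acos (dot x y) in yE *.
have th0 : 0 <= th by rewrite acos_ge0// sphere_dot_itv.
pose g t := Sphere (great_circle_norm (t * th) ee xe).
pose v t := th *: (cos (t * th) *: e - sin (t * th) *: sphere_val x).
have dcos (t : R) : is_derive t 1 (fun s => cos (s * th)) (- sin (t * th) * th).
  apply: (@is_derive1_comp _ cos (fun s => s * th)).
  by apply: is_derive_eq; rewrite [X in X + _]scaler0 add0r [LHS]mulr1.
have dsin (t : R) : is_derive t 1 (fun s => sin (s * th)) (cos (t * th) * th).
  apply: (@is_derive1_comp _ sin (fun s => s * th)).
  by apply: is_derive_eq; rewrite [X in X + _]scaler0 add0r [LHS]mulr1.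
have dc (p q : 'rV[R]_m.+1) i (t : R) :
    is_derive t 1 (fun s : R => (cos (s * th) *: p + sin (s * th) *: q) ord0 i)
      ((th *: (cos (t * th) *: q - sin (t * th) *: p)) ord0 i).
  rewrite (_ : (fun s => _) = (fun s => p ord0 i * cos (s * th) + q ord0 i * sin (s * th))); last first.
    by apply/funext => s; rewrite !mxE; congr (_ + _); rewrite mulrC.
  have h := is_deriveD (is_deriveZ (p ord0 i) (dcos t)) (is_deriveZ (q ord0 i) (dsin t)).
  by apply: (is_derive_eq h); rewrite !mxE /GRing.scale/=; ring.
have dg (p q : 'rV[R]_m.+1) (t : R) : derivable (fun s : R => cos (s * th) *: p + sin (s * th) *: q) t 1.
  by apply/derivable_mxP => i j; rewrite ord1; apply: ex_derive; exact: dc.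
have gv : derive1 (fun s => sphere_val (g s)) = v.
  apply/funext => t; rewrite derive1E derive_mx; last exact: dg.
  by apply/rowP => j; rewrite mxE; apply: derive_val; exact: dc.
exists g.
  split.
  - split; first by move=> t; exact: dg.
    rewrite gv => t.
    rewrite (_ : v = (fun s => cos (s * th) *: (th *: e) + sin (s * th) *: (- (th *: sphere_val x)))).
      by apply/differentiable_continuous/derivable1_diffP; exact: dg.
    apply/funext => s; rewrite /v scalerBr !scalerN !scalerA.
    by rewrite (mulrC th) (mulrC th).
  - by apply: val_inj; rewrite /= mul0r cos0 sin0 scale1r scale0r addr0.
  - by apply: val_inj; rewrite /= mul1r -yE.
rewrite /curve_length gv.
have vn t : enorm (v t) = th.
  rewrite /v enormZ ger0_norm// (_ : enorm _ = 1) ?mulr1//; apply/eqP; apply: sphere_of_dot.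
  rewrite !(dotBl, dotBr, dotZl, dotZr) sphere_dot ee (dotC e) xe.
  by rewrite !mulr0 !mulr1 subr0 sub0r mulrN opprK -!expr2 cos2Dsin2.
under eq_Rintegral do rewrite vn.
rewrite Rintegral_cst//= lebesgue_measure_itv/= lte_fin ltr01 sube0/=.
by rewrite mulr1.
Qed.

(** The arc of great circle attains the lower bound on lengths of curves. *)
Lemma geodesic_distE x y : (0 < m)%N -> geodesic_dist x y = acos (dot x y).
Proof.
move=> m0; have [g [Cg g0 g1] gl] := curve_great_circle x y m0.
have lb : lbound [set curve_length h | h in [set h | [/\ C1_curve h, h 0 = x & h 1 = y]]]
    (acos (dot x y)).
  by move=> _ [h [Ch h0 h1] <-]; rewrite dotC -h0 -h1; exact: curve_length_ge.
have inS : [set curve_length h | h in [set h | [/\ C1_curve h, h 0 = x & h 1 = y]]]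
    (acos (dot x y)) by exists g.
apply/eqP; rewrite eq_le; apply/andP; split.
  by apply: ge_inf => //; exists (acos (dot x y)).
by apply: lb_le_inf => //; exists (acos (dot x y)).
Qed.

Lemma cos_geodesic_dist x y : (0 < m)%N -> cos (geodesic_dist x y) = dot x y.
Proof. by move=> m0; rewrite geodesic_distE// acosK// in_itv/= sphere_dot_itv. Qed.

End geodesic.

(** * Independent samples *)

Section independence.
Context {R : realType} {d d' : measure_display}.
Context {Omega : measurableType d} {T : measurableType d'}.
Variables (P : probability Omega R) (n : nat) (X : 'I_n -> {RV P >-> T}).
Hypothesis indX : mutually_independent X.
Local Open Scope ereal_scope.

Let mX i : measurable_fun setT (X i).
Proof. exact: measurable_funP. Qed.

(** Independence is given for events, so factors beyond the k-th are restricted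
    to indicators and k is the induction variable.  In the step, as a function
    of the event put in place of the k-th factor, the expectation of the product
    is a multiple of the law of the k-th sample, and
    [integral_image_density] replaces the event by a function. *)
Lemma expectation_prod_partial (k : nat) (h : 'I_n -> T -> R) :
  (forall i, measurable_fun setT (h i)) -> (forall i t, (0 <= h i t)%R) ->
  (forall i, \int[P]_w (h i (X i w))%:E < +oo) ->
  (forall i : 'I_n, (k <= i)%N -> exists2 B, measurable B & h i = \1_B) ->
  \int[P]_w (\prod_(i < n) h i (X i w))%R%:E = \prod_(i < n) \int[P]_w (h i (X i w))%:E.
Proof.
elim: k h => [|k IH] h mh h0 hoo hB.
  pose B i := sval (cid2 (hB i (leq0n i))).
  have mB i : measurable (B i) by rewrite /B; case: cid2.
  have hE i : h i = \1_(B i) by rewrite /B; case: cid2.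
  transitivity (P (\bigcap_(i in [set` [set: 'I_n]%SET]) X i @^-1` B i)).
    set C := \bigcap_(i in _) _.
    have mC : measurable C.
      apply: fin_bigcap_measurable => //= i _; rewrite -[X in measurable X]setTI.
      exact: mX.
    have -> : P C = \int[P]_w (\1_C w)%:E by rewrite integral_indic// setIT.
    apply: eq_integral => w _; congr EFin; rewrite indicE.
    have [/set_mem hw|hw] := boolP (w \in _).
      by rewrite big1// => i _; rewrite hE indicE mem_set//; apply: hw; rewrite /= inE.
    have [i hi] : exists i, ~ B i (X i w).
      apply/existsNP => hall; move/negP : hw; apply; apply/mem_set => i _; exact: hall.
    by rewrite (bigD1 i)//= hE indicE memNset// mul0r.
  rewrite indX//; apply: eq_big => [i|i _]; first by rewrite inE.
  under eq_integral do rewrite hE -[\1_(B i) (X i _)]/(\1_(X i @^-1` B i) _).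
  rewrite integral_indic ?setIT// -[X in measurable X]setTI; exact: mX.
have [kn|kn] := ltnP k n; last first.
  by apply: IH => // i ki; have := ltn_ord i; rewrite ltnNge (leq_trans kn ki).
pose k0 := Ordinal kn.
pose W w := (\prod_(i < n | i != k0) h i (X i w))%R.
have mhX i : measurable_fun setT (fun w => h i (X i w)) by exact: measurableT_comp.
have mW : measurable_fun setT W.
  rewrite /W; under eq_fun do rewrite -big_filter.
  by apply: measurable_prod => i _; exact: mhX.
have W0 w : (0 <= W w)%R by apply: prodr_ge0 => i _.
pose c := (\prod_(i < n | i != k0) fine (\int[P]_w (h i (X i w))%:E))%R.
have I0 i : 0 <= \int[P]_w (h i (X i w))%:E by apply: integral_ge0 => w _; rewrite lee_fin.
have c0 : (0 <= c)%R by apply: prodr_ge0 => i _; exact: fine_ge0.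
have cE : c%:E = \prod_(i < n | i != k0) \int[P]_w (h i (X i w))%:E.
  rewrite /c (big_morph EFin EFinM erefl); apply: eq_bigr => i _.
  by rewrite fineK// ge0_fin_numE.
pose nu : {measure set T -> \bar R} := mscale (NngNum c0) (distribution P (X k0)).
have nuE B : measurable B -> nu B = \int[P]_(w in X k0 @^-1` B) (W w)%:E.
  move=> mB; pose h' i := if i == k0 then \1_B else h i.
  have mXB : measurable (X k0 @^-1` B) by rewrite -[X in measurable X]setTI; exact: mX.
  have -> : \int[P]_(w in X k0 @^-1` B) (W w)%:E = \int[P]_w (\prod_(i < n) h' i (X i w))%R%:E.
    rewrite integral_mkcond; apply: eq_integral => w _; rewrite patchE.
    rewrite (bigD1 k0)//= {1}/h' eqxx indicE.
    have -> : (w \in X k0 @^-1` B) = (X k0 w \in B).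
      by apply/idP/idP => /set_mem hw; apply/mem_set.
    case: ifP => _; rewrite ?mul0r// mul1r; congr EFin.
    by apply: eq_bigr => i /negPf ik; rewrite /h' ik.
  have IB : \int[P]_w (h' k0 (X k0 w))%:E = P (X k0 @^-1` B).
    rewrite /h' eqxx -[RHS](_ : \int[P]_w (\1_(X k0 @^-1` B) w)%:E = _)//.
    by rewrite integral_indic// setIT.
  rewrite IH.
  - rewrite (bigD1 k0)//= IB /nu/= /mscale/= cE muleC; congr (_ * _).
    by apply: eq_bigr => i /negPf ik; rewrite /h' ik.
  - by move=> i; rewrite /h'; case: ifP => // _; exact: measurable_indic.
  - by move=> i t; rewrite /h'; case: ifP.
  - move=> i; have [->|ik] := eqVneq i k0; first by rewrite IB (le_lt_trans (probability_le1 P mXB))// ltry.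
    by rewrite /h' (negPf ik).
  - move=> i ki; rewrite /h'; case: ifPn => [_|ik]; first by exists B.
    apply: hB; rewrite ltn_neqAle ki andbT; apply: contra ik => /eqP e.
    by apply/eqP/val_inj; rewrite /= e.
have mk : measurable_fun setT (fun t => (h k0 t)%:E) by exact/measurable_EFinP.
have hk0 t : 0 <= (h k0 t)%:E by rewrite lee_fin.
have := integral_image_density (mX k0) mW W0 nuE mk hk0.
rewrite ge0_integral_mscale// ge0_integral_distribution//= cE => E.
rewrite (bigD1 k0)//= muleC E.
by apply: eq_integral => w _; rewrite -EFinM (bigD1 k0).
Qed.

Lemma expectation_prod (h : 'I_n -> T -> R) :
  (forall i, measurable_fun setT (h i)) -> (forall i t, (0 <= h i t)%R) ->
  (forall i, \int[P]_w (h i (X i w))%:E < +oo) ->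
  \int[P]_w (\prod_(i < n) h i (X i w))%R%:E = \prod_(i < n) \int[P]_w (h i (X i w))%:E.
Proof.
move=> mh h0 hoo; apply: (expectation_prod_partial (k := n)) => // i.
by rewrite leqNgt ltn_ord.
Qed.

(** Markov's inequality for the exponential of the sum, whose expectation is a
    product by independence. *)
Lemma chernoff (g : T -> R) (M a : R) : measurable_fun setT g ->
  (forall i, \int[P]_w (expR (g (X i w)))%:E <= M%:E) ->
  P [set w | (a <= \sum_(i < n) g (X i w))%R] <= (M ^+ n * expR (- a))%:E.
Proof.
move=> mg gM.
have me : measurable_fun setT (fun t => expR (g t)).
  by apply: measurableT_comp mg; exact: measurable_expR.
have mS : measurable_fun setT (fun w => (\sum_(i < n) g (X i w))%R).
  by apply: measurable_sum => i; exact: measurableT_comp.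
set A := [set w | _].
have mA : measurable A.
  rewrite (_ : A = (fun w => \sum_(i < n) g (X i w))%R @^-1` `[a, +oo[%classic).
    by rewrite -[X in measurable X]setTI; apply: mS => //; exact: measurable_itv.
  by apply/seteqP; split => w; rewrite /A/= in_itv/= andbT.
have I0 i : 0 <= \int[P]_w (expR (g (X i w)))%:E.
  by apply: integral_ge0 => w _; rewrite lee_fin expR_ge0.
have Ifin i : \int[P]_w (expR (g (X i w)))%:E = (fine (\int[P]_w (expR (g (X i w)))%:E))%:E.
  by rewrite fineK// ge0_fin_numE// (le_lt_trans (gM i))// ltry.
have : (expR a)%:E * P A <= (M ^+ n)%:E.
  have -> : (expR a)%:E * P A = \int[P]_(w in A) (expR a)%:E by rewrite integral_cst.
  apply: (@le_trans _ _ (\int[P]_w (\prod_(i < n) expR (g (X i w)))%R%:E)).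
    rewrite [leLHS]integral_mkcond; apply: ge0_le_integral => //.
    - by move=> w _; rewrite patchE; case: ifP => // _; rewrite lee_fin expR_ge0.
    - by apply/(measurable_restrictT _ mA).1.
    - apply/measurable_EFinP; apply: measurable_prod => i _; exact: (measurableT_comp me (mX i)).
    move=> w _; rewrite patchE; case: ifPn => [|_]; last first.
      by rewrite lee_fin prodr_ge0// => i _; exact: expR_ge0.
    by rewrite inE/= => wA; rewrite lee_fin -expR_sum ler_expR.
  rewrite (expectation_prod (h := fun=> expR \o g))//; last first.
  - by move=> i; rewrite /= Ifin ltry.
  - by move=> i t; exact: expR_ge0.
  rewrite /=; under eq_bigr do rewrite Ifin.
  rewrite -(big_morph EFin EFinM erefl) lee_fin -[X in (M ^+ X)%R]card_ord -prodr_const.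
  apply: ler_prod => i _; rewrite fine_ge0//=.
  by rewrite -lee_fin -Ifin.
by rewrite expRN mulrC EFinM lee_pdivlMl ?expR_gt0.
Qed.

End independence.

(** * Moments of the von Mises-Fisher law *)

Section exponential_inequalities.
Context {R : realType}.
Implicit Types y : R.

(** From exp(- y) >= 1 - y and (1 - y) (1 + y + 2 y^2) = 1 + y^2 (1 - 2 y). *)
Lemma expR_le_quadratic y : y <= 2^-1 -> expR y <= 1 + y + 2 * y ^+ 2.
Proof.
move=> y2; have h : 1 - y <= expR (- y) by exact: expR_ge1Dx.
have y1 : 0 < 1 - y by rewrite subr_gt0 (le_lt_trans y2)// invf_lt1 ?ltr1n.
rewrite expRN in h.
have : expR y <= (1 - y)^-1 by rewrite -[expR y]invrK lef_pV2// posrE ?invr_gt0 ?expR_gt0.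
move=> /le_trans; apply; rewrite -[(_)^-1]mul1r ler_pdivrMr//.
have := sqr_ge0 y; nra.
Qed.

Lemma expR_sym_le y : `|y| <= 2^-1 -> expR y + expR (- y) <= 2 + 4 * y ^+ 2.
Proof.
rewrite ler_norml => /andP[y1 y2].
have h1 := expR_le_quadratic y2.
have h2 : expR (- y) <= 1 - y + 2 * (- y) ^+ 2 by apply: expR_le_quadratic; rewrite lerNl.
rewrite sqrrN in h2; lra.
Qed.

(** With X = exp y and Y = exp (- y), the difference of the exponential terms is
    (X - 1)^2 + (Y - 1)^2 + (X + Y - 2); one of the squares is at least y^2,
    according to the sign of y. *)
Lemma expR_sym_ge y :
  expR y + expR (- y) + y ^+ 2 <= expR (2 * y) + expR (- (2 * y)).
Proof.
have h1 := expR_ge1Dx y; have h2 := expR_ge1Dx (- y).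
rewrite -mulrN !mulr2n !mulrDl !mul1r !expRD.
set X := expR y in h1 *; set Y := expR (- y) in h2 *.
have p1 : 0 < X := expR_gt0 _; have p2 : 0 < Y := expR_gt0 _.
have XY : X * Y = 1 by rewrite /X /Y -expRD subrr expR0.
have [y0|y0] := leP 0 y; nra.
Qed.

Lemma sphere_dot_le m (x : sphere R m) (u : 'rV[R]_m.+1) : `|dot x u| <= enorm u.
Proof.
have h v : dot x v <= enorm v.
  by rewrite (le_trans (dot_le_enorm _ _))// (eqP (sphere_valP x)) mul1r.
by rewrite ler_norml h andbT lerNl -dotNr (le_trans (h _))// /enorm dotNl dotNr opprK.
Qed.

End exponential_inequalities.

Section sphere_moments.
Context {R : realType} {m : nat}.
Local Open Scope ereal_scope.
Implicit Types (u v : 'rV[R]_m.+1) (alpha : sphere R m).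
Notation sigma := (@sphere_vol R m).

Lemma sphere_sum_sqr (x : 'rV[R]_m.+1) : (\sum_(i < m.+1) x ord0 i ^+ 2 = dot x x)%R.
Proof. by apply: eq_bigr => i _; rewrite expr2. Qed.

Lemma measurable_sqr_dot u :
  measurable_fun setT (fun x : sphere R m => ((dot x u) ^+ 2)%:E).
Proof. by apply/measurable_EFinP; apply: measurable_funX; exact: measurable_sphere_dot. Qed.

Lemma measurable_expR_dot (c : R) u :
  measurable_fun setT (fun x : sphere R m => (expR (c * dot x u))%:E).
Proof.
apply/measurable_EFinP; apply: measurableT_comp; first exact: measurable_expR.
by apply: measurable_funM => //; exact: measurable_sphere_dot.
Qed.

Lemma integral_sqr_dot_swap u v : dot u u = dot v v ->
  \int[sigma]_x ((dot x u) ^+ 2)%:E = \int[sigma]_x ((dot x v) ^+ 2)%:E.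
Proof.
move=> uv; rewrite -(integral_sphere_refl (u - v) (measurable_sqr_dot u)); last first.
  by move=> x; rewrite lee_fin sqr_ge0.
by apply: eq_integral => x _; rewrite /= dot_reflC refl_swap.
Qed.

(** The integral is the same for all unit vectors, and the m + 1 squared
    coordinates add up to 1. *)
Lemma integral_sqr_dot alpha :
  m.+1%:R%:E * \int[sigma]_x ((dot x alpha) ^+ 2)%:E = sigma setT.
Proof.
transitivity (\sum_(i < m.+1) \int[sigma]_x ((dot x (delta_mx ord0 i)) ^+ 2)%:E).
  under eq_bigr do rewrite -(@integral_sqr_dot_swap alpha) ?sphere_dot ?dot_delta ?mxE ?eqxx//.
  by rewrite sumr_const card_ord mule_natl.
rewrite -ge0_integral_sum//; last 2 first.
- by move=> i; exact: measurable_sqr_dot.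
- by move=> i x _; rewrite lee_fin sqr_ge0.
rewrite -[RHS](mul1e (sigma setT)) -integral_cst//; apply: eq_integral => x _.
rewrite sumEFin; congr EFin; rewrite -(sphere_dot x) -sphere_sum_sqr.
by apply: eq_bigr => i _; rewrite dot_delta.
Qed.

Lemma integral_expR_dot_opp alpha (c : R) :
  \int[sigma]_x (expR (c * dot x alpha))%:E = \int[sigma]_x (expR (- c * dot x alpha))%:E.
Proof.
rewrite -(integral_sphere_refl (alpha : 'rV_m.+1)); last 2 first.
- exact: measurable_expR_dot.
- by move=> x; rewrite lee_fin expR_ge0.
apply: eq_integral => x _; rewrite /= /refl dotBl dotZl sphere_dot.
by rewrite divr1 mulr1; congr ((expR _)%:E); ring.
Qed.

End sphere_moments.

Section vMF_moments.
Context {R : realType} {m : nat}.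
Local Open Scope ereal_scope.
Notation sigma := (@sphere_vol R m).
Variables (m_gt0 : (0 < m)%N) (alpha : sphere R m) (beta : R).
Hypothesis beta_gt0 : (0 < beta)%R.
Variable nu : {measure set (sphere R m) -> \bar R}.
Hypothesis nu1 : nu setT = 1.
Hypothesis nuE : forall A, measurable A ->
  nu A = \int[sigma]_(x in A) (vMF_density x alpha beta)%:E.
Implicit Types u v : 'rV[R]_m.+1.

Let Z := vMF_Z alpha beta.

Lemma vMF_densityE x : vMF_density x alpha beta = (expR (beta * dot x alpha) / Z)%R.
Proof. by rewrite /vMF_density cos_geodesic_dist. Qed.

Let Z_ge0 : (0 <= Z)%R.
Proof. by apply: Rintegral_ge0 => x _; exact: expR_ge0. Qed.

Lemma measurable_vMF_density :
  measurable_fun setT (fun x => vMF_density x alpha beta).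
Proof.
under eq_fun do rewrite vMF_densityE.
apply: measurable_funM => //; apply/measurable_EFinP; exact: measurable_expR_dot.
Qed.

Lemma vMF_density_ge0 x : (0 <= vMF_density x alpha beta)%R.
Proof. by rewrite vMF_densityE divr_ge0// expR_ge0. Qed.

Lemma integral_vMF (f : sphere R m -> \bar R) :
  measurable_fun setT f -> (forall x, 0 <= f x) ->
  \int[nu]_x f x = \int[sigma]_x (f x * (vMF_density x alpha beta)%:E).
Proof.
apply: (integral_image_density (phi := id)) => //.
- exact: measurable_vMF_density.
- exact: vMF_density_ge0.
Qed.

(** An infinite normalizing integral would also make Z vanish, and with it the
    density; but the total mass of the law is 1. *)
Lemma vMF_Z_gt0 : (0 < Z)%R.
Proof.
rewrite lt_neqAle Z_ge0 andbT; apply/eqP => Z0.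
have := nu1; rewrite nuE// integral0_eq ?eqe => [/eqP|x _]; first by rewrite eq_sym onee_eq0.
by rewrite vMF_densityE -Z0 invr0 mulr0.
Qed.

Lemma integral_sphere_vMF (f : sphere R m -> R) :
  measurable_fun setT f -> (forall x, (0 <= f x)%R) ->
  Z%:E * \int[nu]_x (f x)%:E = \int[sigma]_x (f x * expR (beta * dot x alpha))%:E.
Proof.
move=> mf f0; rewrite integral_vMF//; last exact/measurable_EFinP.
rewrite -ge0_integralZl//.
- apply: eq_integral => x _; rewrite -!EFinM vMF_densityE; congr EFin; field.
  by rewrite gt_eqF// vMF_Z_gt0.
- apply: emeasurable_funM; first exact/measurable_EFinP.
  by apply/measurable_EFinP; exact: measurable_vMF_density.
- by move=> x _; rewrite mule_ge0// lee_fin ?vMF_density_ge0.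
Qed.

Lemma integral_expR_vMF_Z : \int[sigma]_x (expR (beta * dot x alpha))%:E = Z%:E.
Proof.
have := @integral_sphere_vMF (cst 1%R) (measurable_cst _) (fun=> ler01).
have -> : \int[nu]_x (cst 1%R x)%:E = 1 by rewrite -[RHS]nu1 -[RHS]mul1e -integral_cst.
rewrite mule1 => ->.
by apply: eq_integral => x _; rewrite mul1r.
Qed.

Lemma integral_vMF_refl u (f : sphere R m -> R) : dot alpha u = 0%R ->
  measurable_fun setT f -> (forall x, (0 <= f x)%R) ->
  \int[nu]_x (f (sphere_refl u x))%:E = \int[nu]_x (f x)%:E.
Proof.
move=> au mf f0.
have mfr : measurable_fun setT (fun x => f (sphere_refl u x)).
  by apply: measurableT_comp => //; exact: measurable_sphere_refl.
have Zn0 : Z != 0%R by rewrite gt_eqF// vMF_Z_gt0.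
suff : Z%:E * \int[nu]_x (f (sphere_refl u x))%:E = Z%:E * \int[nu]_x (f x)%:E.
  move=> /(congr1 (fun t => (Z^-1)%:E * t)); rewrite !muleA -!EFinM mulVf ?mul1e//.
rewrite !integral_sphere_vMF// -(integral_sphere_refl u (f := fun x => (f x * _)%:E)).
- by apply: eq_integral => x _; rewrite /= dot_reflC refl_id.
- apply/measurable_EFinP; apply: measurable_funM => //; apply/measurable_EFinP.
  exact: measurable_expR_dot.
- by move=> x; rewrite lee_fin mulr_ge0// expR_ge0.
Qed.

(** Reflections that fix alpha exchange u with each v_j, where the v_j have the
    norm of u and are pairwise orthogonal and orthogonal to alpha; hence m times
    the variance is at most |u|^2. *)
Lemma vMF_orthogonal_variance u : dot alpha u = 0%R ->
  \int[nu]_x ((dot x u) ^+ 2)%:E <= (dot u u / m%:R)%:E.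
Proof.
move=> au.
pose e0 : 'rV[R]_m.+1 := delta_mx ord0 ord0.
(* h exchanges alpha and the first basis vector, so that it maps the other
   basis vectors to an orthonormal basis of the orthogonal of alpha *)
pose h := refl (sphere_val alpha - e0).
have e00 : dot e0 e0 = 1%R by rewrite dot_delta mxE !eqxx.
have ha : h alpha = e0 by apply: refl_swap; rewrite sphere_dot e00.
pose v (j : 'I_m) : 'rV[R]_m.+1 := enorm u *: h (delta_mx ord0 (lift ord0 j)).
have vv j : dot u u = dot (v j) (v j).
  by rewrite /v dotZl dotZr dot_refl dot_delta mxE !eqxx mulr1 -expr2 sqr_enorm.
have av j : dot alpha (v j) = 0%R.
  by rewrite /v dotZr /h -dot_reflC -/h ha dot_delta mxE eq_sym (negPf (neq_lift _ _)) andbF mulr0.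
have msq w : measurable_fun setT (fun x : sphere R m => (dot x w ^+ 2)%R).
  by apply/measurable_EFinP; exact: measurable_sqr_dot.
have uE j : \int[nu]_x ((dot x u) ^+ 2)%:E = \int[nu]_x ((dot x (v j)) ^+ 2)%:E.
  rewrite -(@integral_vMF_refl (u - v j)%R (fun x => dot x u ^+ 2)%R)//.
  - by apply: eq_integral => x _; rewrite /= dot_reflC refl_swap// -vv.
  - by rewrite dotBr au av subr0.
  - by move=> x; exact: sqr_ge0.
have m0 : (0 < m%:R :> R)%R by rewrite ltr0n.
have : m%:R%:E * \int[nu]_x ((dot x u) ^+ 2)%:E <= (dot u u)%:E.
  have -> : m%:R%:E * \int[nu]_x ((dot x u) ^+ 2)%:E =
      \sum_(j < m) \int[nu]_x ((dot x (v j)) ^+ 2)%:E.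
    under eq_bigr do rewrite -uE.
    by rewrite sumr_const card_ord mule_natl.
  rewrite -ge0_integral_sum//; last 2 first.
  - by move=> i; exact/measurable_EFinP.
  - by move=> i x _; rewrite lee_fin sqr_ge0.
  rewrite -[leRHS]mule1 -nu1 -integral_cst//; apply: ge0_le_integral => //.
  - by move=> x _; apply: sume_ge0 => j _; rewrite lee_fin sqr_ge0.
  - by apply: emeasurable_sum => j; exact/measurable_EFinP.
  move=> x _; rewrite sumEFin lee_fin.
  under eq_bigr do rewrite /v dotZr exprMn sqr_enorm -dot_reflC dot_delta.
  rewrite -mulr_sumr ler_piMr ?dot_ge0// -(sphere_dot x) -(dot_refl (sphere_val alpha - e0) x x).
  by rewrite -sphere_sum_sqr big_ord_recl lerDr sqr_ge0.
rewrite EFinM -lee_pdivlMl//; by rewrite muleC.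
Qed.

(** The reflection in the hyperplane orthogonal to u fixes alpha, so the odd part
    of the exponential does not contribute. *)
Lemma vMF_orthogonal_mgf u (l : R) : dot alpha u = 0%R ->
  (`|l| * enorm u <= 2^-1)%R ->
  \int[nu]_x (expR (l * dot x u))%:E <= (1 + 2 * l ^+ 2 * dot u u / m%:R)%:E.
Proof.
move=> au lu; set I := \int[nu]_x _.
have mexp c : measurable_fun setT (fun x : sphere R m => expR (c * dot x u)).
  by apply/measurable_EFinP; exact: measurable_expR_dot.
have IN : I = \int[nu]_x (expR (- (l * dot x u)))%:E.
  have [u0|u0] := eqVneq u 0%R.
    by apply: eq_integral => x _; rewrite u0 dot0r mulr0 oppr0.
  rewrite /I -(@integral_vMF_refl u (fun x => expR (l * dot x u))%R)//.
  apply: eq_integral => x _; rewrite /= /refl dotBl dotZl; congr ((expR _)%:E).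
  by field; rewrite dot_eq0.
have II : I + I <= \int[nu]_x (2 + 4 * (l * dot x u) ^+ 2)%:E.
  have me1 : measurable_fun setT (fun x : sphere R m => (expR (l * dot x u))%:E).
    exact: measurable_expR_dot.
  have me2 : measurable_fun setT (fun x : sphere R m => (expR (- (l * dot x u)))%:E).
    by under eq_fun do rewrite -mulNr; exact: measurable_expR_dot.
  rewrite {2}IN -ge0_integralD//.
  apply: ge0_le_integral => //.
  - by move=> x _; rewrite adde_ge0// lee_fin expR_ge0.
  - exact: emeasurable_funD.
  - apply/measurable_EFinP; apply: measurable_funD => //; apply: measurable_funM => //.
    by apply: measurable_funX; apply: measurable_funM => //; exact: measurable_sphere_dot.
  move=> x _; rewrite -EFinD lee_fin expR_sym_le//.
  by rewrite normrM (le_trans _ lu)// ler_wpM2l//; exact: sphere_dot_le.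
have msq : measurable_fun setT (fun x : sphere R m => ((dot x u) ^+ 2)%:E).
  exact: measurable_sqr_dot.
have II2 : I + I <= (2 + 4 * l ^+ 2 * (dot u u / m%:R))%:E.
  apply: (le_trans II).
  under eq_integral do rewrite exprMn mulrA EFinD EFinM.
  rewrite ge0_integralD//; last 2 first.
  - by move=> x _; rewrite -EFinM lee_fin mulr_ge0 ?sqr_ge0// mulr_ge0 ?sqr_ge0.
  - exact: emeasurable_funM.
  have -> : \int[nu]_x 2%:E = 2%:E by rewrite -[RHS]mule1 -nu1 -integral_cst.
  rewrite ge0_integralZl_EFin//; last 2 first.
  - by move=> x _; rewrite lee_fin sqr_ge0.
  - by rewrite mulr_ge0// sqr_ge0.
  have l4 : (0 <= 4 * l ^+ 2)%R by rewrite mulr_ge0 ?sqr_ge0.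
  rewrite (EFinD 2) leeD2l// [leRHS]EFinM lee_wpmul2l ?lee_fin//.
  exact: vMF_orthogonal_variance.
move: I II2 {IN II} => [i||]//=; rewrite ?leNye// !lee_fin.
set w := (dot u u / m%:R)%R; rewrite -(mulrA (2 * l ^+ 2)%R) -/w => h.
have : (4 * l ^+ 2 * w = 2 * (2 * l ^+ 2 * w))%R by ring.
move: h; set w' := (2 * l ^+ 2 * w)%R => + E; rewrite E => h; lra.
Qed.

(** Averaging with the reflected point replaces the exponentials by hyperbolic
    cosines.  [expR_sym_ge] with y = (beta / 2) <x, alpha> then bounds the gain
    from below by a multiple of the integral of <x, alpha>^2, which is the
    volume of the sphere divided by m + 1; and Z is at most exp beta times this
    volume. *)
Lemma vMF_pole_mgf :
  \int[nu]_x (expR (- (beta / 2) * dot x alpha))%:E <=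
  (1 - beta / 2 * (beta / 4 * expR (- beta) / m.+1%:R))%:E.
Proof.
set A := \int[nu]_x _.
have mexp c : measurable_fun setT (fun x : sphere R m => (expR (c * dot x alpha))%:E).
  exact: measurable_expR_dot.
have msq := @measurable_sqr_dot R m alpha.
have e0 c (x : sphere R m) : 0 <= (expR (c * dot x alpha))%:E by rewrite lee_fin expR_ge0.
have ZA : Z%:E * A = \int[sigma]_x (expR (beta / 2 * dot x alpha))%:E.
  rewrite integral_sphere_vMF; last 2 first.
  - apply/(measurable_EFinP setT (fun x : sphere R m => expR (- (beta / 2) * dot x alpha))).
    exact: mexp.
  - by move=> x; exact: expR_ge0.
  by apply: eq_integral => x _; rewrite -expRD; congr ((expR _)%:E); field.
set T := \int[sigma]_x ((dot x alpha) ^+ 2)%:E.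
have ineq : Z%:E * A + Z%:E * A + (beta ^+ 2 / 4)%:E * T <= Z%:E + Z%:E.
  rewrite {2}ZA (integral_expR_dot_opp alpha (beta / 2)) ZA.
  rewrite -{2}integral_expR_vMF_Z (integral_expR_dot_opp alpha beta) -integral_expR_vMF_Z.
  rewrite -ge0_integralZl_EFin//; last 2 first.
  - by move=> x _; rewrite lee_fin sqr_ge0.
  - by rewrite divr_ge0// sqr_ge0.
  rewrite -!ge0_integralD//; last 4 first.
  - by move=> x _; rewrite adde_ge0.
  - exact: emeasurable_funD.
  - by move=> x _; rewrite -EFinM lee_fin mulr_ge0 ?divr_ge0 ?sqr_ge0.
  - exact: emeasurable_funM.
  apply: ge0_le_integral => //.
  - by move=> x _; rewrite !adde_ge0// -EFinM lee_fin mulr_ge0 ?divr_ge0 ?sqr_ge0.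
  - by apply: emeasurable_funD; [exact: emeasurable_funD|exact: emeasurable_funM].
  - exact: emeasurable_funD.
  move=> x _; rewrite -EFinM -!EFinD lee_fin.
  have := expR_sym_ge (beta / 2 * dot x alpha).
  rewrite (_ : 2 * (beta / 2 * dot x alpha) = beta * dot x alpha)%R; last by field.
  by rewrite -!mulNr (_ : (beta / 2 * dot x alpha) ^+ 2 = beta ^+ 2 / 4 * dot x alpha ^+ 2)%R//; field.
have TS : m.+1%:R%:E * T = sigma setT by exact: integral_sqr_dot.
have ZS : Z%:E <= (expR beta)%:E * sigma setT.
  rewrite -integral_expR_vMF_Z -integral_cst//; apply: ge0_le_integral => //.
  move=> x _; rewrite /= lee_fin ler_expR ler_piMr ?(ltW beta_gt0)//.
  by have /andP[] := sphere_dot_itv x alpha.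
have A0 : 0 <= A by apply: integral_ge0 => x _.
have T0 : 0 <= T by apply: integral_ge0 => x _; rewrite lee_fin sqr_ge0.
have Z0 := vMF_Z_gt0.
have Zm0 : Z%:E * A + Z%:E * A <= Z%:E + Z%:E.
  by apply: le_trans ineq; rewrite leeDl// mule_ge0// lee_fin divr_ge0// sqr_ge0.
move: A A0 ineq Zm0 {ZA} => [a||]// A0 ineq Zm0; last first.
  by move: Zm0; rewrite gt0_muley ?lte_fin// -EFinD.
move: T T0 TS ineq => [t||]// T0 TS ineq; last first.
  by move: ineq; rewrite gt0_muley ?lte_fin ?divr_gt0 ?exprn_gt0// -!EFinM -!EFinD addey.
rewrite -TS -!EFinM lee_fin in ZS.
rewrite -!EFinM -!EFinD !lee_fin in ineq A0 T0 *.
have M0 : (0 < m.+1%:R :> R)%R by rewrite ltr0n.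
have tl : (Z * expR (- beta) / m.+1%:R <= t)%R.
  rewrite ler_pdivrMr// expRN ler_pdivrMr ?expR_gt0//.
  by rewrite (le_trans ZS)// mulrC (mulrC t).
have : (2 * Z * a <= 2 * Z - beta ^+ 2 / 4 * (Z * expR (- beta) / m.+1%:R))%R.
  have : (beta ^+ 2 / 4 * (Z * expR (- beta) / m.+1%:R) <= beta ^+ 2 / 4 * t)%R.
    by rewrite ler_wpM2l// divr_ge0// sqr_ge0.
  move=> h; rewrite lerBrDr (_ : 2 * Z = Z + Z)%R; last by ring.
  by apply: le_trans ineq; rewrite mulrDl lerD2l.
move=> h; rewrite -(ler_pM2l (_ : 0 < 2 * Z)%R)//; last by rewrite mulr_gt0.
apply: (le_trans h); rewrite le_eqVlt; apply/orP; left; apply/eqP.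
by move: M0; set M := m.+1%:R => M0; field; rewrite gt_eqF.
Qed.

End vMF_moments.

(** * Deterministic bound on the estimator *)

Section deterministic.
Context {R : realType}.

(** The difference vanishes at 0 and has derivative x sin x. *)
Lemma mulr_cos_le_sin (x : R) : 0 <= x <= pi -> x * cos x <= sin x.
Proof.
move=> /andP[x0 xpi]; pose f (y : R) := sin y - y * cos y.
have df (y : R) : is_derive y 1 f (y * sin y).
  have h := is_deriveB (is_derive_sin y) (is_deriveM (is_derive_id y (1 : R)) (is_derive_cos y)).
  by apply: (is_derive_eq h); rewrite /GRing.scale/=; ring.
have cf : {within `[0, x], continuous f}.
  apply: continuous_subspaceT => y.
  by apply/differentiable_continuous/derivable1_diffP/ex_derive.
have [c] := MVT_segment x0 (fun y _ => df y) cf.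
rewrite in_itv/= => /andP[c0 cx]; rewrite {1 2}/f sin0 mul0r !subr0 => fE.
by rewrite -subr_ge0 fE !mulr_ge0// sin_ge0_pi// c0 (le_trans cx).
Qed.

(** The net is made of the points of norm at most 2 of the grid of mesh 1 / N in
    the cube [-1, 1]^n with N = 2 n: rounding each coordinate moves a vector by at
    most sqrt n / N, which is at most 1 / 2. *)
Lemma finite_net (n : nat) : (0 < n)%N -> exists s : seq 'rV[R]_n,
  (forall v, v \in s -> enorm v <= 2) /\
  (forall u, dot u u = 1 -> exists2 v, v \in s & enorm (u - v) <= 2^-1).
Proof.
move=> n0; pose N := (2 * n)%N.
have N0 : 0 < N%:R :> R by rewrite ltr0n muln_gt0.
pose vf (f : {ffun 'I_n -> 'I_(2 * N).+1}) : 'rV[R]_n := \row_i ((f i)%:R / N%:R - 1).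
exists [seq v <- [seq vf f | f <- enum {: {ffun 'I_n -> 'I_(2 * N).+1}}] | enorm v <= 2].
split=> [v|u uu]; first by rewrite mem_filter => /andP[].
pose f : {ffun 'I_n -> 'I_(2 * N).+1} := [ffun i => inord (Num.truncn ((u ord0 i + 1) * N%:R))].
have ui i : `|u ord0 i| <= 1.
  rewrite -(ler_pXn2r (isT : (0 < 2)%N)) ?nnegrE// expr1n real_normK ?num_real//.
  by rewrite -uu /dot (bigD1 i)//= expr2 lerDl sumr_ge0// => j _; rewrite -expr2 sqr_ge0.
have fi i : `|(u - vf f) ord0 i| <= N%:R^-1.
  have := ui i; rewrite ler_norml => /andP[h1 h2].
  have y0 : 0 <= (u ord0 i + 1) * N%:R by rewrite mulr_ge0 ?(ltW N0)//; lra.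
  have /andP[t1 t2] := truncn_itv y0.
  have tb : (Num.truncn ((u ord0 i + 1) * N%:R) < (2 * N).+1)%N.
    rewrite ltnS -(ler_nat R) (le_trans t1)// natrM ler_wpM2r ?(ltW N0)//; lra.
  rewrite !mxE ffunE inordK//; set t := (Num.truncn _)%:R in t1 t2 *.
  have t2' : (u ord0 i + 1) * N%:R < t + 1 by move: t2; rewrite -natr1.
  rewrite (_ : _ - _ = ((u ord0 i + 1) * N%:R - t) / N%:R); last by field; rewrite gt_eqF.
  rewrite normrM normfV (gtr0_norm N0) ler_piMl ?invr_ge0 ?(ltW N0)//.
  rewrite ger0_norm ?subr_ge0// ; lra.
have close : enorm (u - vf f) <= 2^-1.
  rewrite -(ler_pXn2r (isT : (0 < 2)%N)) ?nnegrE ?enorm_ge0 ?invr_ge0// sqr_enorm.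
  apply: (@le_trans _ _ (\sum_(i < n) N%:R^-1 ^+ 2)).
    apply: ler_sum => i _; rewrite -expr2 -real_normK ?num_real//.
    by rewrite ler_pXn2r// nnegrE ?invr_ge0 ?(ltW N0).
  have n1 : 1 <= n%:R :> R by rewrite ler1n.
  have n1' : 0 < n%:R :> R by rewrite (lt_le_trans ltr01).
  rewrite sumr_const card_ord (_ : _ *+ n = (4 * n%:R)^-1); last first.
    by rewrite -mulr_natr /N natrM; field; rewrite gt_eqF.
  rewrite (_ : 2^-1 ^+ 2 = 4^-1); last by field.
  by rewrite lef_pV2 ?posrE ?mulr_gt0// ler_peMr.
exists (vf f) => //; rewrite mem_filter map_f ?mem_enum// andbT.
rewrite -(ler_pXn2r (isT : (0 < 2)%N)) ?nnegrE ?enorm_ge0//.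
rewrite sqr_enorm -[vf f](subKr u); move: (u - vf f) close => w close.
rewrite !(dotBl, dotBr) uu (dotC w u).
have h1 : - dot u w <= enorm w.
  rewrite -dotNl (le_trans (dot_le_enorm _ _))// /enorm dotNl dotNr opprK uu.
  by rewrite sqrtr1 mul1r.
have h2 : dot w w <= 2^-1 ^+ 2.
  by rewrite -sqr_enorm ler_pXn2r// nnegrE ?enorm_ge0 ?invr_ge0.
have h3 : 2^-1 ^+ 2 = 4^-1 :> R by field.
rewrite h3 in h2; rewrite (_ : 2 ^+ 2 = 4); [lra|by rewrite -natrX].
Qed.

Definition orth_proj n (a v : 'rV[R]_n) := v - dot v a *: a.

Lemma dot_orth_proj n (a v w : 'rV[R]_n) :
  dot (orth_proj a v) w = dot v (orth_proj a w).
Proof. by rewrite /orth_proj !(dotBl, dotBr, dotZl, dotZr) (dotC w a); ring. Qed.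

(** A point of the net at distance at most 1 / 2 from p / |p| has inner product at
    least |p| / 2 with p. *)
Lemma enorm_le_net n (s : seq 'rV[R]_n) (p : 'rV[R]_n) (q : R) :
  (forall u, dot u u = 1 -> exists2 v, v \in s & enorm (u - v) <= 2^-1) ->
  0 <= q -> (forall v, v \in s -> dot p v <= q) -> enorm p <= 2 * q.
Proof.
move=> net q0 pq; have [->|p0] := eqVneq p 0.
  by rewrite /enorm dot0l sqrtr0 mulr_ge0.
have ep : 0 < enorm p by rewrite enorm_gt0.
have [|v vs uv] := net ((enorm p)^-1 *: p).
  by rewrite dotZl dotZr -sqr_enorm; field; rewrite gt_eqF.
have pv := pq v vs.
set u := _ *: p in uv.
have pu : dot p u = enorm p by rewrite /u dotZr -sqr_enorm; field; rewrite gt_eqF.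
have : dot p (u - v) <= enorm p * 2^-1.
  by rewrite (le_trans (dot_le_enorm _ _))// ler_wpM2l// ltW.
rewrite dotBr pu; lra.
Qed.

Variable m : nat.
Implicit Types a alpha : sphere R m.

(** The maximizer a is S / |S|, by the equality case of the Cauchy-Schwarz
    inequality.  For the angle th this gives |S| cos th = <S, alpha> and
    |S| sin th = |orth_proj alpha S|, and th cos th <= sin th. *)
Lemma acos_argmax_le (S : 'rV[R]_m.+1) a alpha (p q : R) :
  (forall b : sphere R m, dot S b <= dot S a) ->
  0 < p -> p <= dot S alpha -> enorm (orth_proj alpha S) <= q ->
  acos (dot a alpha) <= q / p.
Proof.
move=> amax p0 pS Sq.
have S0 : S != 0 by apply: contraTneq (lt_le_trans p0 pS) => ->; rewrite dot0l ltxx.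
have eS : 0 < enorm S by rewrite enorm_gt0.
have bP : enorm ((enorm S)^-1 *: S) == 1.
  by rewrite enormZ ger0_norm ?invr_ge0 ?enorm_ge0// mulVf// gt_eqF.
have Sa : enorm S <= dot S a.
  have := amax (Sphere bP); rewrite /= dotZr -sqr_enorm expr2 mulKf//.
  by rewrite gt_eqF.
have SE : S = enorm S *: sphere_val a.
  apply/eqP; rewrite -subr_eq0 -dot_eq0 eq_le dot_ge0 andbT.
  rewrite !(dotBl, dotBr, dotZl, dotZr) sphere_dot (dotC a S) -sqr_enorm.
  have : enorm S * enorm S <= enorm S * dot S a by rewrite ler_wpM2l// ltW.
  rewrite expr2; lra.
have dE : dot S alpha = enorm S * dot a alpha by rewrite [in LHS]SE dotZl.
set th := acos (dot a alpha).
have dI := sphere_dot_itv a alpha.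
have ct : cos th = dot a alpha by rewrite /th acosK// in_itv/=.
have pE : enorm (orth_proj alpha S) = enorm S * sin th.
  rewrite /th sin_acos//; apply/eqP; rewrite -(eqrXn2 (isT : (0 < 2)%N)) ?enorm_ge0//; last first.
    by rewrite mulr_ge0 ?sqrtr_ge0 ?enorm_ge0.
  rewrite exprMn !sqr_enorm sqr_sqrtr ?subr_ge0.
    rewrite /orth_proj !(dotBl, dotBr, dotZl, dotZr) sphere_dot (dotC alpha S) dE -sqr_enorm.
    by apply/eqP; ring.
  by rewrite -(expr1n _ 2) -real_normK ?num_real// lerXn2r ?nnegrE// sphere_dot_norm.
have th0 : 0 <= th by exact: acos_ge0.
have ths : th * cos th <= sin th by apply: mulr_cos_le_sin; rewrite th0 acos_lepi.
rewrite ler_pdivlMr//.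
apply: (@le_trans _ _ (th * dot S alpha)); first by rewrite ler_wpM2l.
apply: le_trans Sq; rewrite pE dE -ct mulrCA ler_wpM2l// ltW//.
Qed.

End deterministic.

(** * Tail bounds and the sample size *)

Section tails.
Context {R : realType} {m : nat} (m_gt0 : (0 < m)%N).
Variables (alpha : sphere R m) (beta : R) (beta_gt0 : 0 < beta).
Context {d : measure_display} {Omega : measurableType d} (P : probability Omega R).
Variables (n : nat) (X : 'I_n -> {RV P >-> sphere R m}).
Hypothesis indX : mutually_independent X.
Hypothesis denX : forall i, has_density (X i) sphere_vol
  (fun x => vMF_density x alpha beta).

Let law1 i : distribution P (X i) setT = 1%E.
Proof. exact: probability_setT. Qed.

Lemma sample_mgf (l : R) (u : 'rV[R]_m.+1) i :
  (\int[P]_w (expR (l * dot (X i w) u))%:E =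
  \int[distribution P (X i)]_x (expR (l * dot x u))%:E)%E.
Proof.
by rewrite ge0_integral_distribution//; exact: measurable_expR_dot.
Qed.

Lemma measurable_scaled_dot (l : R) (u : 'rV[R]_m.+1) :
  measurable_fun setT (fun x : sphere R m => l * dot x u).
Proof. by apply: measurable_funM => //; exact: measurable_sphere_dot. Qed.

Lemma measurable_sum_dot (u : 'rV[R]_m.+1) :
  measurable_fun setT (fun w => \sum_(i < n) dot (X i w) u).
Proof.
apply: measurable_sum => i.
exact: (measurableT_comp (measurable_sphere_dot u) (measurable_funP (X i))).
Qed.

(** Chernoff with l = m s / 16; the bound m s <= 4 is what makes l |u| at most
    1 / 2. *)
Lemma orthogonal_tail (u : 'rV[R]_m.+1) (s : R) : dot alpha u = 0 ->
  enorm u <= 2 -> 0 < s -> m%:R * s <= 4 ->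
  (P [set w | (n%:R * s <= \sum_(i < n) dot (X i w) u)%R] <=
   (expR (- (m%:R * (n%:R * s ^+ 2) / 32)))%:E)%E.
Proof.
move=> au u2 s0 ms.
have m0 : 0 < m%:R :> R by rewrite ltr0n.
pose l := m%:R * s / 16.
have l0 : 0 < l by rewrite divr_gt0// mulr_gt0.
have uu : dot u u <= 4.
  rewrite -sqr_enorm (_ : 4 = 2 ^+ 2); last by rewrite -natrX.
  by rewrite ler_pXn2r ?nnegrE ?enorm_ge0.
have mgf i : (\int[P]_w (expR (l * dot (X i w) u))%:E <= (expR (8 * l ^+ 2 / m%:R))%:E)%E.
  rewrite sample_mgf; apply: (le_trans (vMF_orthogonal_mgf m_gt0 (law1 i) (denX i) au _)).
    rewrite gtr0_norm// (@le_trans _ _ (l * 2))// ?ler_pM2l// /l; lra.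
  rewrite lee_fin; apply: (@le_trans _ _ (1 + 8 * l ^+ 2 / m%:R)); last exact: expR_ge1Dx.
  rewrite lerD2l ler_pM2r ?invr_gt0//.
  have : l ^+ 2 * dot u u <= l ^+ 2 * 4 by rewrite ler_wpM2l// sqr_ge0.
  by rewrite -mulrA; lra.
rewrite (_ : [set w | _] = [set w | l * (n%:R * s) <= \sum_(i < n) l * dot (X i w) u]); last first.
  by apply/funext => w /=; rewrite -mulr_sumr ler_pM2l.
have := chernoff indX (l * (n%:R * s)) (measurable_scaled_dot l u) mgf.
move=> /le_trans; apply; rewrite lee_fin -expRM_natl -expRD ler_expR le_eqVlt.
by apply/orP; left; apply/eqP; rewrite /l -mulr_natl; field; rewrite gt_eqF.
Qed.

Let kappa := beta / 4 * expR (- beta) / m.+1%:R.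

Lemma pole_tail :
  (P [set w | (\sum_(i < n) dot (X i w) alpha <= n%:R * (kappa / 2))%R] <=
   (expR (- (n%:R * (beta * kappa / 4))))%:E)%E.
Proof.
pose l := - (beta / 2).
have mgf i : (\int[P]_w (expR (l * dot (X i w) alpha))%:E <= (expR (l * kappa))%:E)%E.
  rewrite sample_mgf; apply: (le_trans (vMF_pole_mgf m_gt0 beta_gt0 (law1 i) (denX i))).
  by rewrite lee_fin -/kappa /l mulNr; exact: expR_ge1Dx.
rewrite (_ : [set w | _] =
    [set w | l * (n%:R * (kappa / 2)) <= \sum_(i < n) l * dot (X i w) alpha]); last first.
  by apply/funext => w /=; rewrite -mulr_sumr /l !mulNr lerN2 ler_pM2l// divr_gt0.
have := chernoff indX (l * (n%:R * (kappa / 2))) (measurable_scaled_dot l alpha) mgf.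
move=> /le_trans; apply; rewrite lee_fin -expRM_natl -expRD ler_expR le_eqVlt.
by apply/orP; left; apply/eqP; rewrite /l -mulr_natl; field.
Qed.

End tails.

Lemma finite_union_bound {R : realType} {d} {T : measurableType d}
    (P : {measure set T -> \bar R}) (I : eqType) (s : seq I) (B : I -> set T) (r : R) :
  (forall v, measurable (B v)) -> 0 <= r ->
  (forall v, v \in s -> P (B v) <= r%:E)%E ->
  exists E, [/\ measurable E, forall v, v \in s -> B v `<=` E &
    (P E <= ((size s)%:R * r)%:E)%E].
Proof.
move=> mB r0; elim: s => [|v s IH] h.
  by exists set0; split=> //; rewrite measure0 mul0r.
have [|E [mE BE PE]] := IH.
  by move=> u us; apply: h; rewrite inE us orbT.
exists (B v `|` E); split.
- exact: measurableU.
- move=> u; rewrite inE => /predU1P[->|/BE uE]; first exact: subsetUl.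
  by apply: (subset_trans uE); exact: subsetUr.
- apply: (le_trans (measureU2 _ (mB v) mE)).
  rewrite /= -natr1 mulrDl mul1r addrC EFinD leeD//.
  by apply: h; rewrite inE eqxx.
Qed.

Section thresholds.
Context {R : realType}.

(** From ln y <= y at y = x^(1/4). *)
Lemma ln_le_sqrt_sqrt (x : R) : 1 <= x -> ln x <= 4 * Num.sqrt (Num.sqrt x).
Proof.
move=> x1; have x0 : 0 < x by exact: lt_le_trans x1.
set y := Num.sqrt (Num.sqrt x).
have y0 : 0 < y by rewrite !sqrtr_gt0.
have xE : x = y ^+ 4 by rewrite (exprM y 2 2) !sqr_sqrtr ?sqrtr_ge0// ltW.
rewrite xE lnXn// -[leLHS]mulr_natl ler_pM2l//.
apply: ltW; rewrite -ltr_expR lnK ?posrE//.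
by apply: lt_le_trans (expR_ge1Dx _); rewrite ltrDr.
Qed.

(** [K] will be the cardinal of the net.  With x = n, L = ln x and r = sqrt x,
    the threshold makes m^4 <= x, used through L <= 4 x^(1/4); r kp >= 128 + m,
    which beats m L^2 / 64 <= m r / 4; and L >= 1 + 64 * 128 K, which makes
    exp(m L^2 / 64) at least 128 K.  Each of the two terms is then at most
    1 / 128 times the exponential on the right. *)
Lemma sample_size_threshold (m K : nat) (kp : R) : (0 < m)%N -> 0 < kp ->
  exists n0 : nat, forall n : nat, (n0 <= n)%N ->
  [/\ (0 < n)%N, 0 < ln (n%:R : R),
    m%:R * (ln n%:R / Num.sqrt n%:R) <= 4 :> R &
    K%:R * expR (- (m%:R * ln n%:R ^+ 2 / 32)) + expR (- (n%:R * kp)) <=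
    64^-1 * expR (- (64^-1 * m%:R * ln n%:R ^+ 2)) :> R].
Proof.
move=> m0 kp0.
pose D : R := 1 + 64 * (128 * K%:R).
pose W : R := expR D + m%:R ^+ 4 + ((128 + m%:R) / kp) ^+ 2 + 2.
exists (Num.truncn W).+1 => n n0n.
have m1 : 1 <= m%:R :> R by rewrite ler1n.
have Kg0 : 0 <= K%:R :> R by rewrite ler0n.
set x : R := n%:R.
have D1 : 1 <= D by rewrite /D lerDl !mulr_ge0.
have e0 : 0 < expR D := expR_gt0 _.
have a0 : 0 <= m%:R ^+ 4 :> R by rewrite exprn_ge0.
have b0 : 0 <= ((128 + m%:R) / kp) ^+ 2 by exact: sqr_ge0.
have W0 : 0 <= W by rewrite /W !addr_ge0// ltW.
have Wx : W < x.
  by have /andP[_ h] := truncn_itv W0; rewrite (lt_le_trans h)// ler_nat.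
have xe : expR D <= x by rewrite /W in Wx; lra.
have xm : m%:R ^+ 4 <= x by rewrite /W in Wx; lra.
have xk : ((128 + m%:R) / kp) ^+ 2 <= x by rewrite /W in Wx; lra.
have x1 : 1 <= x by rewrite /W in Wx; lra.
have x0 : 0 < x by exact: lt_le_trans x1.
set r := Num.sqrt x; set y := Num.sqrt r.
have rr : r ^+ 2 = x by rewrite sqr_sqrtr// ltW.
have yy : y ^+ 2 = r by rewrite sqr_sqrtr// sqrtr_ge0.
have r0 : 0 < r by rewrite sqrtr_gt0.
have y0 : 0 < y by rewrite sqrtr_gt0.
have Ly : ln x <= 4 * y by exact: ln_le_sqrt_sqrt.
have LD : D <= ln x by rewrite -[D]expRK ler_ln// posrE.
have L0 : 0 < ln x by rewrite (lt_le_trans ltr01)// (le_trans D1).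
have my : m%:R <= y.
  rewrite -(ler_pXn2r (isT : (0 < 4)%N)) ?nnegrE ?ler0n ?(ltW y0)//.
  by rewrite (exprM y 2 2) yy rr.
have kr : (128 + m%:R) / kp <= r.
  by rewrite -(ler_pXn2r (isT : (0 < 2)%N)) ?nnegrE ?(ltW r0) ?divr_ge0 ?addr_ge0 ?(ltW kp0)// rr.
have LL : ln x ^+ 2 <= 16 * r.
  rewrite -yy (_ : 16 * y ^+ 2 = (4 * y) ^+ 2); last by ring.
  by rewrite ler_pXn2r// nnegrE ltW// mulr_gt0.
have r1 : 1 <= r by rewrite -sqrtr1 ler_wsqrtr.
split => //; first by rewrite -(ltr_nat R).
  rewrite mulrA ler_pdivrMr// (le_trans (_ : _ <= y * (4 * y)))//.
    by rewrite ler_pM// ltW.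
  by rewrite mulrCA -expr2 yy.
set q := m%:R * ln x ^+ 2.
have q0 : 0 <= q by rewrite mulr_ge0// sqr_ge0.
rewrite (_ : 64^-1 * m%:R * ln x ^+ 2 = q / 64); last by rewrite /q; ring.
set Ee := expR (- (q / 64)).
have Ee0 : 0 < Ee := expR_gt0 _.
have h1 : K%:R * expR (- (q / 32)) <= 128^-1 * Ee.
  have qD : D <= q.
    rewrite /q (le_trans LD)// (le_trans (_ : _ <= ln x ^+ 2))//.
      by rewrite expr2 ler_peMl ?(ltW L0)// (le_trans D1).
    by rewrite ler_peMl// sqr_ge0.
  have : 128 * K%:R <= expR (q / 64).
    apply: le_trans (expR_ge1Dx _); rewrite /D in qD; lra.
  have -> : expR (- (q / 32)) = Ee * Ee by rewrite -expRD; congr expR; field.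
  rewrite -(ler_pM2r Ee0) -expRD subrr expR0 => h.
  have := ler_wpM2r (ltW Ee0) h; rewrite mul1r; lra.
have h2 : expR (- (x * kp)) <= 128^-1 * Ee.
  have h128 : expR (- 128) <= 128^-1 :> R.
    rewrite expRN lef_pV2 ?posrE ?expR_gt0//.
    by apply: le_trans (expR_ge1Dx _); rewrite lerDr.
  apply: (@le_trans _ _ (expR (- 128) * Ee)); last by rewrite ler_pM2r.
  rewrite -expRD ler_expR -opprD lerN2.
  have hk : 128 + m%:R <= r * kp by rewrite -ler_pdivrMr.
  have hq : q / 64 <= m%:R * r / 4.
    have : q <= m%:R * (16 * r) by rewrite /q ler_wpM2l// (le_trans _ m1).
    lra.
  apply: (@le_trans _ _ ((128 + m%:R) * r)).
    have : 0 <= m%:R * r by rewrite mulr_ge0 ?(ltW r0)// ltW// (lt_le_trans ltr01).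
    have : 128 <= 128 * r by rewrite ler_peMr.
    rewrite mulrDl; lra.
  by rewrite -rr expr2 -mulrA mulrC ler_wpM2l// ltW.
rewrite -/q; lra.
Qed.

End thresholds.

(** * The estimator *)

Lemma vMF_MLE_argmax {R : realType} {m : nat} (m_gt0 : (0 < m)%N) (n : nat)
    (x : 'I_n -> sphere R m) (a b : sphere R m) : vMF_MLE x a ->
  dot (\sum_(i < n) sphere_val (x i)) b <= dot (\sum_(i < n) sphere_val (x i)) a.
Proof.
move=> /(_ b); rewrite !dot_suml.
by under eq_bigr do rewrite cos_geodesic_dist//;
   under [X in _ <= X -> _]eq_bigr do rewrite cos_geodesic_dist//.
Qed.

Theorem theorem7p3 (R : realType) (beta : R) (beta_gt0 : 0 < beta) :
  exists c C : R, [/\ 0 < c, 0 < C &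
    forall (m : nat), (0 < m)%N -> forall alpha_tr : sphere R m,
    exists n0 : nat, forall n : nat, (n0 <= n)%N ->
    forall (d : measure_display) (Omega : measurableType d)
      (P : probability Omega R) (X : 'I_n -> {RV P >-> sphere R m}),
    mutually_independent X ->
    (forall i, has_density (X i) sphere_vol
      (fun x => vMF_density x alpha_tr beta)) ->
    with_probability_ge P (1 - c * expR (- (c * m%:R * ln n%:R ^+ 2)))
      [set w | forall alpha_hat, vMF_MLE (fun i => X i w) alpha_hat ->
         geodesic_dist alpha_hat alpha_tr
           <= C * m%:R * ln n%:R / Num.sqrt n%:R]].
Proof.
exists 64^-1, (32 * expR beta / beta).
split=> [||m m0 alpha]; first by rewrite invr_gt0.
  by rewrite divr_gt0 ?mulr_gt0 ?expR_gt0.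
have [net [net2 netP]] := @finite_net R m.+1 isT.
pose kappa : R := beta / 4 * expR (- beta) / m.+1%:R.
have kappa0 : 0 < kappa by rewrite !mulr_gt0 ?invr_gt0 ?expR_gt0.
have [|n0 n0P] := @sample_size_threshold R m (size net) (beta * kappa / 4) m0.
  by apply: divr_gt0 => //; exact: mulr_gt0.
exists n0 => n n0n d Omega P X indX denX.
have [n_gt0 L0 ms bound] := n0P n n0n.
have r0 : 0 < Num.sqrt n%:R :> R by rewrite sqrtr_gt0 ltr0n.
pose s : R := ln n%:R / Num.sqrt n%:R.
have s0 : 0 < s by rewrite divr_gt0.
have ns : n%:R * s ^+ 2 = ln n%:R ^+ 2 :> R.
  by rewrite /s exprMn exprVn sqr_sqrtr ?ler0n//; field; rewrite pnatr_eq0 -lt0n.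
pose u v := orth_proj (sphere_val alpha) v.
have au v : dot alpha (u v) = 0.
  by rewrite /u /orth_proj dotBr dotZr sphere_dot mulr1 (dotC alpha) subrr.
have u2 v : v \in net -> enorm (u v) <= 2.
  move=> /net2; apply: le_trans.
  rewrite -(ler_pXn2r (isT : (0 < 2)%N)) ?nnegrE ?enorm_ge0// !sqr_enorm.
  rewrite /u /orth_proj !(dotBl, dotBr, dotZl, dotZr) sphere_dot (dotC alpha).
  by have := sqr_ge0 (dot v alpha); nra.
pose B v := [set w | n%:R * s <= \sum_(i < n) dot (X i w) (u v)].
have mB v : measurable (B v).
  rewrite (_ : B v = (fun w => \sum_(i < n) dot (X i w) (u v)) @^-1` `[n%:R * s, +oo[%classic).
    by rewrite -[X in measurable X]setTI; apply: measurable_sum_dot => //; exact: measurable_itv.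
  by apply/seteqP; split => w; rewrite /B/= in_itv/= andbT.
pose B0 := [set w | \sum_(i < n) dot (X i w) alpha <= n%:R * (kappa / 2)].
have mB0 : measurable B0.
  rewrite (_ : B0 = (fun w => \sum_(i < n) dot (X i w) alpha) @^-1` `]-oo, n%:R * (kappa / 2)]%classic).
    by rewrite -[X in measurable X]setTI; apply: measurable_sum_dot => //; exact: measurable_itv.
  by apply/seteqP; split => w; rewrite /B0/= in_itv/=.
have [||E [mE BE PE]] := @finite_union_bound R d Omega P _ net B
    (expR (- (m%:R * (n%:R * s ^+ 2) / 32))) mB.
- exact: expR_ge0.
- by move=> v vnet; apply: (orthogonal_tail m0 indX denX) => //; exact: u2.
have PB0 := pole_tail m0 beta_gt0 indX denX.
exists (~` (E `|` B0)); last first.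
  rewrite probability_setC; last exact: measurableU.
  rewrite EFinB leeB//.
  apply: (le_trans (measureU2 _ mE mB0)).
  apply: (@le_trans _ _ ((size net)%:R * expR (- (m%:R * ln n%:R ^+ 2 / 32)) +
      expR (- (n%:R * (beta * kappa / 4))))%:E); last by rewrite lee_fin.
  by rewrite EFinD leeD// -ns.
split; first by apply: measurableC; exact: measurableU.
move=> w /= /not_orP[wE wB0] a /(vMF_MLE_argmax m0) amax.
set S := \sum_(i < n) _ in amax.
have pS : n%:R * (kappa / 2) <= dot S alpha.
  by rewrite /S dot_suml leNgt; apply/negP => /ltW.
have qS : enorm (orth_proj alpha S) <= 2 * (n%:R * s).
  apply: (enorm_le_net netP); first by rewrite mulr_ge0 ?ler0n// ltW.
  move=> v vnet; rewrite dot_orth_proj /S dot_suml leNgt; apply/negP => /ltW vB.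
  by apply: wE; exact: (BE v vnet).
have n0' : 0 < n%:R :> R by rewrite ltr0n.
have p0 : 0 < n%:R * (kappa / 2) by apply: mulr_gt0 => //; exact: divr_gt0.
rewrite geodesic_distE//.
apply: (le_trans (acos_argmax_le amax p0 pS qS)).
have -> : 2 * (n%:R * s) / (n%:R * (kappa / 2)) = 16 * m.+1%:R * expR beta / beta * s.
  rewrite /kappa expRN; field.
  by rewrite !gt_eqF ?expR_gt0 ?ltr0n.
rewrite (_ : 32 * expR beta / beta * m%:R * ln n%:R / Num.sqrt n%:R =
   16 * (2 * m%:R) * expR beta / beta * s); last by rewrite /s; ring.
rewrite ler_pM2r// ler_pM2r ?invr_gt0// ler_pM2r ?expR_gt0// ler_pM2l//.
by rewrite -natrM ler_nat mul2n -addnn -addn1 leq_add2l.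
Qed.
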